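(* Let $H$ be an $n$-dimensional compact Lie group and let $A$ be any $n$-dimensional abelian Lie group, with Lie algebras $\mathfrak{h}$ and $\mathfrak{a}$. Then the product Lie group $G=H\times A$ (with Lie algebra $\mathfrak{g}=\mathfrak{h}\oplus\mathfrak{a}$) admits a left-invariant almost Hermitian structure $(J,\langle\cdot,\cdot\rangle)$ such that, denoting by $\nabla^t$ ($t\in\mathbb{R}$) the $t$-Gauduchon connection of $(G,J,\langle\cdot,\cdot\rangle)$: (1) $J$ is totally real with respect to $\mathfrak{h}$; (2) $\nabla^{t}=0$ for $t=2$ (i.e. $\nabla^2_XY=0$ for all $X,Y\in\mathfrak{g}$), and $\nabla^2$ has totally skew-symmetric torsion $T^2$, i.e. $\langle T^2(X,Y),Z\rangle$ is skew-symmetric in $X,Y,Z$; (3) $\nabla^{t}$ is flat (and nontrivial) for $t=-2$. Moreover, if $T^B$ denotes the torsion of the Gauduchon connection $\nabla^2$ and $\beta\in\wedge^3\mathfrak{g}^\ast$ is the left-invariant 3-form defined by $\beta(X,Y,Z):=\langle T^B(X,Y),Z\rangle$, then $\beta$ is closed.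
   Context: The Lie algebra $\mathfrak{g}$ of a Lie group $G$ is the space of left-invariant vector fields. A left-invariant almost Hermitian structure $(J,\langle\cdot,\cdot\rangle)$ on $G$ consists of a left-invariant almost complex structure $J$ and a left-invariant Riemannian metric $\langle\cdot,\cdot\rangle$ with $\langle JX,JY\rangle=\langle X,Y\rangle$. For $G=H\times A$, $J$ is called totally real with respect to $\mathfrak{h}$ if $J\mathfrak{h}=\mathfrak{a}$. The fundamental 2-form is $\omega(X,Y):=\langle JX,Y\rangle$; the exterior derivative is normalized so that for left-invariant fields $d\omega(X,Y,Z)=-\omega([X,Y],Z)-\omega([Y,Z],X)-\omega([Z,X],Y)$. The Nijenhuis tensor is $N(X,Y):=J[JX,Y]+J[X,JY]+[X,Y]-[JX,JY]$. For a real 3-form $\eta$, $\eta^+$ denotes its $(2,1)+(1,2)$-part with respect to $J$; explicitly $\eta^+(X,Y,Z)=\frac14[3\eta(X,Y,Z)+\eta(JX,JY,Z)+\eta(JX,Y,JZ)+\eta(X,JY,JZ)]$. The torsion of a connection $\nabla$ is $T(X,Y)=\nabla_XY-\nabla_YX-[X,Y]$, and a connection compatible with the metric is uniquely determined by its torsion, which may be any $TG$-valued 2-form. For $t\in\mathbb{R}$, the $t$-Gauduchon connection $\nabla^t$ is the unique connection with $\nabla^t\langle\cdot,\cdot\rangle=0$ whose torsion $T^t$ is $$\langle T^t(X,Y),Z\rangle=-\tfrac14\langle N(X,Y),Z\rangle-\left(\tfrac{t-2}{4}\right)(d\omega)^+(X,Y,JZ)+\left(\tfrac{3t-2}{4}\right)(d\omega)^+(JX,JY,JZ).$$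 A connection is flat if its curvature $R(X,Y)Z=[\nabla_X,\nabla_Y]Z-\nabla_{[X,Y]}Z$ vanishes. For a left-invariant connection (one with $\nabla_XY\in\mathfrak{g}$ for all $X,Y\in\mathfrak{g}$), $\nabla=0$ (the trivial connection) means $\nabla_XY=0$ for all $X,Y\in\mathfrak{g}$; nontrivial means not the trivial connection.
   Formalization: Nontriviality of the flat connection for t = -2 is asserted only when the Lie algebra of H is not abelian; if it is abelian (e.g. H a torus), all brackets vanish and every t-Gauduchon connection is trivial, so the claim fails there. *)

(* Defs.v *)
From HB Require Import structures.
From mathcomp Require Import all_boot all_order all_algebra.
From mathcomp Require Import all_classical all_reals all_analysis.
From mathcomp Require Import ring.

Set Implicit Arguments.
Unset Strict Implicit.
Unset Printing Implicit Defensive.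

Import Order.TTheory GRing.Theory Num.Theory.
Import numFieldNormedType.Exports.

Local Open Scope classical_set_scope.
Local Open Scope ring_scope.

Section Smooth.
Context {R : realType}.

(* Class C^k on [U]. This is meant for an open [U] and finite-dimensional model
   spaces, for which continuity of all directional derivatives amounts to
   continuity of the differential. *)
Fixpoint Ck {E F : normedModType R} (k : nat) (U : set E) (f : E -> F) : Prop :=
  match k with
  | 0 => forall x, U x -> {for x, continuous f}
  | k.+1 => (forall x, U x -> differentiable f x) /\
            (forall v : E, Ck k U ('D_v f))
  end.

Definition smooth_on {E F : normedModType R} (U : set E) (f : E -> F) : Prop :=
  forall k, Ck k U f.

Lemma near_eq_differentiable {E F : normedModType R} (f g : E -> F) (x : E) :
  (\near x, f x = g x) -> differentiable f x -> differentiable g x.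
Proof.
move=> fg df; have -> : g = f + (g - f) by rewrite addrC subrK.
apply: differentiableD => //; set h := g - f.
have hx : \near x, h x = 0.
  by apply: filterS fg => y; rewrite /h !fctE => ->; rewrite subrr.
have E0 : h \o shift x = cst (h x) + (\0 : {linear E -> F}) +o_ 0 id.
  apply/eqaddoP => _/posnumP[e].
  have : \forall y \near 0, h (y + x) = 0.
    by rewrite (near_shift x); apply: filterS hx => y; rewrite /= sub0r subrK.
  apply: filterS => y hy; rewrite !fctE /= hy (nbhs_singleton hx) !addr0 subrr.
  by rewrite normr0 mulr_ge0.
have ctn0 : continuous (\0 : {linear E -> F}) by apply: cst_continuous.
by apply/diff_locallyP; rewrite (diff_unique ctn0 E0); split.
Qed.

Lemma eq_Ck {E F : normedModType R} k (U : set E) (f g : E -> F) :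
  open U -> (forall x, U x -> f x = g x) -> Ck k U f -> Ck k U g.
Proof.
move=> oU; elim: k f g => [|k IH] f g fg /=.
  move=> cf x Ux; rewrite /prop_for /continuous_at -fg//.
  apply: cvg_trans (cf x Ux); apply: near_eq_cvg.
  have := open_nbhs_nbhs (conj oU Ux); apply: filterS => y; exact: fg.
move=> [df Df]; have nfg x : U x -> \near x, f x = g x.
  move=> Ux; have := open_nbhs_nbhs (conj oU Ux); apply: filterS => y; exact: fg.
split=> [x Ux|v]; first exact/(near_eq_differentiable (nfg x Ux))/df.
by apply: IH (Df v) => x Ux; apply/near_eq_derive/nfg.
Qed.

Lemma Ck_continuous {E F : normedModType R} k (U : set E) (f : E -> F) :
  Ck k U f -> forall x, U x -> {for x, continuous f}.
Proof. by case: k => // k [df _] x /df /differentiable_continuous. Qed.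

Lemma Ck_le {E F : normedModType R} k (U : set E) (f : E -> F) :
  Ck k.+1 U f -> Ck k U f.
Proof.
elim: k f => [|k IH] f; first exact: Ck_continuous.
by move=> [df Df]; split=> // v; apply/IH/Df.
Qed.

Lemma Ck_cst {E F : normedModType R} k (U : set E) (a : F) : Ck k U (cst a).
Proof.
elim: k a => [|k IH] a /=; first by move=> x _; apply: cst_continuous.
split=> [x _|v]; first exact: differentiable_cst.
suff -> : 'D_v (cst a) = cst 0 by apply: IH.
by apply/funext => x; rewrite derive_cst.
Qed.

Lemma CkD {E F : normedModType R} k (U : set E) (f g : E -> F) :
  open U -> Ck k U f -> Ck k U g -> Ck k U (f \+ g).
Proof.
move=> oU; elim: k f g => [|k IH] f g /= => [cf cg x Ux|[df Df] [dg Dg]].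
  by apply: continuousD; [apply: cf|apply: cg].
split=> [x Ux|v]; first by apply: differentiableD; [apply: df|apply: dg].
apply: eq_Ck (IH _ _ (Df v) (Dg v)) => // x Ux.
by rewrite [RHS]deriveD //; apply: diff_derivable; [apply: df|apply: dg].
Qed.

Lemma CkM {E : normedModType R} k (U : set E) (f g : E -> R^o) :
  open U -> Ck k U f -> Ck k U g -> Ck k U (f \* g).
Proof.
move=> oU; elim: k f g => [|k IH] f g => [cf cg x Ux|cf cg].
  by apply: continuousM; [apply: cf|apply: cg].
have [df Df] := cf; have [dg Dg] := cg.
split=> [x Ux|v]; first by apply: differentiableM; [apply: df|apply: dg].
have := CkD oU (IH _ _ (Ck_le cf) (Dg v)) (IH _ _ (Ck_le cg) (Df v)).
apply: eq_Ck => // x Ux.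
by rewrite [RHS]deriveM //; apply: diff_derivable; [apply: df|apply: dg].
Qed.

Lemma Ck_pair {E F F' : normedModType R} k (U : set E) (f : E -> F)
    (g : E -> F') :
  open U -> Ck k U f -> Ck k U g -> Ck k U (fun x => (f x, g x)).
Proof.
move=> oU; elim: k f g => [|k IH] f g /= => [cf cg x Ux|[df Df] [dg Dg]].
  by apply: cvg_pair; [apply: cf|apply: cg].
split=> [x Ux|v]; first by apply: differentiable_pair; [apply: df|apply: dg].
apply: eq_Ck (IH _ _ (Df v) (Dg v)) => // x Ux.
have [dfx dgx] := (df x Ux, dg x Ux).
rewrite (deriveE _ dfx) (deriveE _ dgx) deriveE; last exact: differentiable_pair.
by rewrite diff_pair.
Qed.

Lemma Ck_linear {E E' F : normedModType R} k (U : set E) (V : set E')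
    (L : E' -> E) (f : E -> F) :
  linear L -> continuous L -> (forall x, V x -> U (L x)) ->
  Ck k U f -> Ck k V (f \o L).
Proof.
move=> linL cL VU.
pose L_linear := GRing.isLinear.Build _ _ _ _ _ linL.
pose L' : {linear E' -> E} := HB.pack L L_linear.
elim: k f => [|k IH] f /= => [cf x Vx|[df Df]].
  by apply: continuous_comp; [apply: cL|apply/cf/VU].
split=> [x Vx|v].
  apply: (@differentiable_comp _ _ _ _ L f); last exact/df/VU.
  exact: (@linear_differentiable _ _ _ L' x cL).
have -> : 'D_v (f \o L) = 'D_(L v) f \o L; last exact/IH/Df.
apply/funext => x /=; rewrite /derive.
by under eq_fun => h do rewrite /= linL.
Qed.

End Smooth.

(* The inverse of a chart is a total function, relevant on [chart_cod] only. *)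
Record chart (R : realType) (E : normedModType R) (M : topologicalType) :=
  Chart {
  chart_dom : set M;
  chart_cod : set E;
  chart_map :> M -> E;
  chart_inv : E -> M;
  chart_dom_open : open chart_dom;
  chart_cod_open : open chart_cod;
  chart_map_cod : forall p, chart_dom p -> chart_cod (chart_map p);
  chart_inv_dom : forall x, chart_cod x -> chart_dom (chart_inv x);
  chart_mapK : forall p, chart_dom p -> chart_inv (chart_map p) = p;
  chart_invK : forall x, chart_cod x -> chart_map (chart_inv x) = x;
  chart_map_continuous :
    forall p, chart_dom p -> {for p, continuous chart_map};
  chart_inv_continuous :
    forall x, chart_cod x -> {for x, continuous chart_inv} }.

HB.mixin Record isManifold (R : realType) (E : normedModType R) M
    of Topological M := {
  atlas : set (chart E M);
  atlas_cover : forall p : M, exists2 c, atlas c & chart_dom c p;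
  atlas_compatible : forall c d, atlas c -> atlas d ->
    smooth_on (chart_cod c `&` chart_inv c @^-1` chart_dom d)
              (d \o chart_inv c);
  manifold_hausdorff : hausdorff_space M;
  manifold_second_countable : @second_countable M }.

#[short(type="manifoldType")]
HB.structure Definition Manifold (R : realType) (E : normedModType R) :=
  {M of isManifold R E M & Topological M}.

Definition smooth_map {R : realType} {E F : normedModType R}
    {M : manifoldType E} {N : manifoldType F} (f : M -> N) : Prop :=
  continuous f /\
  forall (c : chart E M) (d : chart F N), atlas c -> atlas d ->
    smooth_on (chart_cod c `&` (f \o chart_inv c) @^-1` chart_dom d)
              (d \o f \o chart_inv c).

Section Product.
Context {R : realType} {E F : normedModType R}.

Lemma setX_open (S T : topologicalType) (A : set S) (B : set T) :
  open A -> open B -> open (A `*` B).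
Proof.
move=> oA oB; rewrite openE => -[p q] [/= Ap Bq].
by exists (A, B) => //; split; apply: open_nbhs_nbhs.
Qed.

Lemma continuous_prodmap (S S' T T' : topologicalType) (f : S -> S')
    (g : T -> T') (p : S * T) :
  {for p.1, continuous f} -> {for p.2, continuous g} ->
  {for p, continuous (fun q => (f q.1, g q.2))}.
Proof.
move=> cf cg; apply: cvg_pair.
  by apply: (@cvg_comp _ _ _ fst f); [exact: cvg_fst|exact: cf].
by apply: (@cvg_comp _ _ _ snd g); [exact: cvg_snd|exact: cg].
Qed.

Program Definition product_chart (M N : topologicalType) (c : chart E M)
    (d : chart F N) : chart (E * F)%type (M * N)%type :=
  @Chart R (E * F)%type (M * N)%type
    (chart_dom c `*` chart_dom d) (chart_cod c `*` chart_cod d)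
    (fun p => (c p.1, d p.2)) (fun x => (chart_inv c x.1, chart_inv d x.2))
    _ _ _ _ _ _ _ _.
Next Obligation. by move=> *; apply: setX_open; apply: chart_dom_open. Qed.
Next Obligation. by move=> *; apply: setX_open; apply: chart_cod_open. Qed.
Next Obligation.
by move=> M N c d p [pc pd]; split; apply: chart_map_cod.
Qed.
Next Obligation.
by move=> M N c d x [xc xd]; split; apply: chart_inv_dom.
Qed.
Next Obligation.
by move=> M N c d [p q] [pc pd] /=; rewrite !chart_mapK.
Qed.
Next Obligation.
by move=> M N c d [x y] [xc xd] /=; rewrite !chart_invK.
Qed.
Next Obligation.
by move=> M N c d p [pc pd]; apply: continuous_prodmap;
   apply: chart_map_continuous.
Qed.
Next Obligation.
by move=> M N c d p [pc pd]; apply: continuous_prodmap;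
   apply: chart_inv_continuous.
Qed.

Context (M : manifoldType E) (N : manifoldType F).

Definition product_atlas : set (chart (E * F)%type (M * N)%type) :=
  [set e | exists c d, [/\ atlas c, atlas d & e = product_chart c d]].

Lemma product_atlas_cover (p : M * N) :
  exists2 c, product_atlas c & chart_dom c p.
Proof.
have [c ac cp] := atlas_cover p.1; have [d ad dp] := atlas_cover p.2.
by exists (product_chart c d) => //; exists c, d.
Qed.

Lemma Ck_prodmap {E' F' : normedModType R} k (U : set E) (V : set F)
    (W : set (E * F)%type) (f : E -> E') (g : F -> F') :
  open W -> W `<=` U `*` V -> Ck k U f -> Ck k V g ->
  Ck k W (fun x => (f x.1, g x.2)).
Proof.
move=> oW WUV cf cg; apply: Ck_pair => //.
  apply: (@Ck_linear _ _ _ _ _ U W fst) => //; last by move=> x /WUV[].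
  by move=> x; apply: cvg_fst.
apply: (@Ck_linear _ _ _ _ _ V W snd) => //; last by move=> x /WUV[].
by move=> x; apply: cvg_snd.
Qed.

Lemma open_chart_preimage {E0 : normedModType R} {S T : topologicalType}
    (c : chart E0 S) (f : S -> T) (A : set T) :
  continuous f -> open A -> open (chart_cod c `&` (f \o chart_inv c) @^-1` A).
Proof.
move=> cf oA; rewrite openE => x [cx Ax]; apply: filterI.
  exact: open_nbhs_nbhs (conj (chart_cod_open c) cx).
have : {for x, continuous (f \o chart_inv c)}.
  by apply: continuous_comp; [apply: chart_inv_continuous|apply: cf].
by apply; apply: open_nbhs_nbhs.
Qed.

Lemma product_atlas_compatible c d : product_atlas c -> product_atlas d ->
  smooth_on (chart_cod c `&` chart_inv c @^-1` chart_dom d) (d \o chart_inv c).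
Proof.
move=> [c1 [c2 [ac1 ac2 ->]]] [d1 [d2 [ad1 ad2 ->]]] k.
apply: Ck_prodmap (atlas_compatible c1 d1 ac1 ad1 k)
                  (atlas_compatible c2 d2 ac2 ad2 k).
  apply: (@open_chart_preimage _ _ _ (product_chart c1 c2) id).
  - by move=> x; apply: cvg_id.
  - exact: (chart_dom_open (product_chart d1 d2)).
by move=> x [[? ?] [? ?]].
Qed.

Lemma product_hausdorff : hausdorff_space (M * N)%type.
Proof.
move=> [p q] [p' q'] cl; congr (_, _).
  apply: (manifold_hausdorff (s := M)) => A B pA pB.
  have [] := cl (A `*` setT) (B `*` setT).
  - by exists (A, setT) => //; split=> //; apply: filterT.
  - by exists (B, setT) => //; split=> //; apply: filterT.
  - by move=> x [[Ax _] [Bx _]]; exists x.1.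
apply: (manifold_hausdorff (s := N)) => A B pA pB.
have [] := cl (setT `*` A) (setT `*` B).
- by exists (setT, A) => //; split=> //; apply: filterT.
- by exists (setT, B) => //; split=> //; apply: filterT.
- by move=> x [[_ Ax] [_ Bx]]; exists x.2.
Qed.

Lemma product_second_countable : @second_countable (M * N)%type.
Proof.
have [B cB [oB bB]] := @manifold_second_countable _ _ M.
have [C cC [oC bC]] := @manifold_second_countable _ _ N.
exists [set A.1 `*` A.2 | A in B `*` C].
  exact/(sub_countable (card_image_le _ _))/countableX.
split=> [_ [[A A'] [/= BA CA'] <-]|[p q] W [[U V] [/= /bB [A [BA Ap] AU]
    /bC [A' [CA' Aq] AV]] UVW]].
  by apply: setX_open; [apply: oB|apply: oC].
exists (A `*` A'); last first.
  by move=> x [? ?]; apply: UVW; split; [apply: AU|apply: AV].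
by split=> //; exists (A, A').
Qed.

HB.instance Definition _ := isManifold.Build R (E * F)%type (M * N)%type
  product_atlas_cover product_atlas_compatible product_hausdorff
  product_second_countable.

End Product.

HB.mixin Record isLieGroup (R : realType) (E : normedModType R) G
    of Group G & Manifold R E G := {
  mulg_smooth : smooth_map (fun p : G * G => (p.1 * p.2)%g);
  invg_smooth : smooth_map (fun x : G => (x^-1)%g) }.

(* A Lie group of dimension [n] is modelled on ['rV[R]_n]; the product of two of
   them is modelled on ['rV[R]_n * 'rV[R]_n]. *)
#[short(type="lieGroupType")]
HB.structure Definition LieGroup (R : realType) (E : normedModType R) :=
  {G of isLieGroup R E G & Group G & Manifold R E G}.

Section ProductGroup.
Variables H A : groupType.
Local Open Scope group_scope.

Let mul (x y : H * A) := (x.1 * y.1, x.2 * y.2).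
Let inv (x : H * A) := (x.1^-1, x.2^-1).

Let mulA : associative mul.
Proof. by move=> x y z; rewrite /mul /= !mulgA. Qed.
Let mul1 : left_id (1, 1) mul.
Proof. by move=> [x y]; rewrite /mul /= !mul1g. Qed.
Let mulr1 : right_id (1, 1) mul.
Proof. by move=> [x y]; rewrite /mul /= !mulg1. Qed.
Let mulV : left_inverse (1, 1) inv mul.
Proof. by move=> [x y]; rewrite /mul /= !mulVg. Qed.
Let mulrV : right_inverse (1, 1) inv mul.
Proof. by move=> [x y]; rewrite /mul /= !mulgV. Qed.

HB.instance Definition _ :=
  isGroup.Build (H * A)%type mulA mul1 mulr1 mulV mulrV.

End ProductGroup.

Section ProductLieGroup.
Context {R : realType} {E F : normedModType R}.
Context (H : lieGroupType E) (A : lieGroupType F).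

Lemma product_mulg_smooth :
  smooth_map (fun p : (H * A) * (H * A) => (p.1 * p.2)%g).
Proof.
have cL (S T : topologicalType) :
    continuous (fun x : (S * T) * (S * T) => (x.1.1, x.2.1)).
  move=> x; apply: cvg_pair.
    by apply: (@cvg_comp _ _ _ fst fst); apply: cvg_fst.
  by apply: (@cvg_comp _ _ _ snd fst); [apply: cvg_snd|apply: cvg_fst].
have cM (S T : topologicalType) :
    continuous (fun x : (S * T) * (S * T) => (x.1.2, x.2.2)).
  move=> x; apply: cvg_pair.
    by apply: (@cvg_comp _ _ _ fst snd); [apply: cvg_fst|apply: cvg_snd].
  by apply: (@cvg_comp _ _ _ snd snd); apply: cvg_snd.
have cH : continuous ((fun q : H * H => (q.1 * q.2)%g) \o
    (fun x : (H * A) * (H * A) => (x.1.1, x.2.1))).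
  by move=> p; apply: continuous_comp; [exact: cL|exact: mulg_smooth.1].
have cA : continuous ((fun q : A * A => (q.1 * q.2)%g) \o
    (fun x : (H * A) * (H * A) => (x.1.2, x.2.2))).
  by move=> p; apply: continuous_comp; [exact: cM|exact: mulg_smooth.1].
have cmul : continuous (fun p : (H * A) * (H * A) => (p.1 * p.2)%g).
  by move=> p; exact: cvg_pair (cH p) (cA p).
split=> // _ _ [_ [_ [[c11 [c12 [a11 a12 ->]]] [c21 [c22 [a21 a22 ->]]] ->]]]
  [d1 [d2 [b1 b2 ->]]] k.
have p1 : product_atlas (product_chart c11 c21) by exists c11, c21.
have p2 : product_atlas (product_chart c12 c22) by exists c12, c22.
have s1 := mulg_smooth.2 (product_chart c11 c21) d1 p1 b1 k.
have s2 := mulg_smooth.2 (product_chart c12 c22) d2 p2 b2 k.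
set W := (X in Ck _ X _).
have oW : open W.
  apply: open_chart_preimage; first exact: cmul.
  exact: (chart_dom_open (product_chart d1 d2)).
apply: Ck_pair => //.
  apply: (Ck_linear _ (@cL _ _) _ s1) => //.
  by move=> x [[[? ?] [? ?]] [? ?]].
apply: (Ck_linear _ (@cM _ _) _ s2) => //.
by move=> x [[[? ?] [? ?]] [? ?]].
Qed.

Lemma product_invg_smooth : smooth_map (fun x : H * A => (x^-1)%g).
Proof.
have cinv : continuous (fun x : H * A => (x^-1)%g).
  by move=> x; apply: continuous_prodmap; apply: invg_smooth.1.
split=> // _ _ [c1 [c2 [a1 a2 ->]]] [d1 [d2 [b1 b2 ->]]] k.
apply: Ck_prodmap (invg_smooth.2 c1 d1 a1 b1 k) (invg_smooth.2 c2 d2 a2 b2 k).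
  apply: open_chart_preimage; first exact: cinv.
  exact: (chart_dom_open (product_chart d1 d2)).
by move=> x [[? ?] [? ?]].
Qed.

HB.instance Definition _ := isLieGroup.Build R (E * F)%type (H * A)%type
  product_mulg_smooth product_invg_smooth.

End ProductLieGroup.

Section SmoothFunctions.
Context {R : realType} {E : normedModType R} (M : manifoldType E).

Definition smooth_fun : {pred M -> R^o} := fun f =>
  `[< forall c : chart E M, atlas c ->
      smooth_on (chart_cod c) (f \o chart_inv c) >].

Record Cinf := MkCinf {
  Cinf_fun :> M -> R^o;
  Cinf_subproof : Cinf_fun \in smooth_fun }.

HB.instance Definition _ := [isSub for Cinf_fun].
HB.instance Definition _ := [Choice of Cinf by <:].

Lemma smooth_fun_cst (a : R^o) : cst a \in smooth_fun.
Proof. by apply/asboolP => c ac k; apply: (@Ck_cst _ _ R^o k _ a). Qed.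

Lemma smooth_funM (f g : M -> R^o) :
  f \in smooth_fun -> g \in smooth_fun -> f * g \in smooth_fun.
Proof.
move=> /asboolP sf /asboolP sg; apply/asboolP => c ac k.
exact: CkM (chart_cod_open c) (sf c ac k) (sg c ac k).
Qed.

Lemma smooth_funD (f g : M -> R^o) :
  f \in smooth_fun -> g \in smooth_fun -> f + g \in smooth_fun.
Proof.
move=> /asboolP sf /asboolP sg; apply/asboolP => c ac k.
exact: CkD (chart_cod_open c) (sf c ac k) (sg c ac k).
Qed.

Lemma smooth_fun_subring_closed : subring_closed smooth_fun.
Proof.
split=> [|f g sf sg|]; [exact: smooth_fun_cst| |exact: smooth_funM].
have -> : f - g = f + cst (-1) * g.
  by apply/funext => x; rewrite !fctE mulN1r.
by apply/smooth_funD/smooth_funM => //; apply: smooth_fun_cst.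
Qed.

Lemma smooth_fun_scaler_closed : GRing.scaler_closed smooth_fun.
Proof.
move=> a f sf; have -> : a *: f = cst (a : R^o) * f by [].
by apply: smooth_funM => //; apply: smooth_fun_cst.
Qed.

HB.instance Definition _ := GRing.isSubringClosed.Build _ smooth_fun
  smooth_fun_subring_closed.
HB.instance Definition _ := GRing.isScaleClosed.Build _ _ smooth_fun
  smooth_fun_scaler_closed.
HB.instance Definition _ :=
  GRing.SubChoice_isSubComPzRing.Build _ _ Cinf (GRing.subringClosedP _).
HB.instance Definition _ := [SubZmodule_isSubLmodule of Cinf by <:].

End SmoothFunctions.

Section LieAlgebra.
Context {R : realType} {E : normedModType R} (G : lieGroupType E).

(* Vector fields are the derivations of the algebra of smooth functions; such a
   derivation is left-invariant if it commutes with [f |-> f \o L_g], where [L_g]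
   is the translation by [g]. *)
Record is_left_invariant_field (X : Cinf G -> Cinf G) : Prop := {
  livf_linear : linear X;
  livf_leibniz : forall f h : Cinf G, X (f * h) = X f * h + f * X h;
  livf_invariant : forall (g : G) (f fg : Cinf G),
    (forall p, fg p = f (g * p)%g) -> forall p, X fg p = X f (g * p)%g }.

Definition left_invariant_field : {pred Cinf G -> Cinf G} :=
  fun X => `[< is_left_invariant_field X >].

Record lieAlg := MkLieAlg {
  lieAlg_field :> Cinf G -> Cinf G;
  lieAlg_subproof : lieAlg_field \in left_invariant_field }.

HB.instance Definition _ := [isSub for lieAlg_field].
HB.instance Definition _ := [Choice of lieAlg by <:].

Lemma lieAlgP (X : lieAlg) : is_left_invariant_field X.
Proof. by case: X => X /= /asboolP. Qed.

Lemma scale_CinfAl (a : R) (f h : Cinf G) : a *: (f * h) = a *: f * h.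
Proof. by apply/val_inj/funext => p; rewrite /= !fctE [LHS]mulrA. Qed.

Lemma scale_CinfAr (a : R) (f h : Cinf G) : a *: (f * h) = f * (a *: h).
Proof. by rewrite mulrC scale_CinfAl mulrC. Qed.

Lemma left_invariant_field_submod_closed :
  submod_closed left_invariant_field.
Proof.
split.
  apply/asboolP; split=> [a f h|f h|g f fg _ p] //.
    by rewrite /= scaler0 addr0.
  by rewrite /= mul0r mulr0 addr0.
move=> a X Y /asboolP[lX dX iX] /asboolP[lY dY iY]; apply/asboolP.
have XYE f : (a *: X + Y) f = a *: X f + Y f by [].
split=> [b f h|f h|g f fg fgE p]; rewrite !XYE.
- rewrite lX lY !scalerDr !scalerA [a * b]mulrC.
  by rewrite !addrA; congr (_ + _); rewrite -!addrA; congr (_ + _); rewrite addrC.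
- rewrite dX dY scalerDr mulrDl mulrDr scale_CinfAl scale_CinfAr.
  by rewrite !addrA; congr (_ + _); rewrite -!addrA; congr (_ + _); rewrite addrC.
- by rewrite [LHS]/= [RHS]/= !fctE /= (iX _ _ _ fgE) (iY _ _ _ fgE).
Qed.

HB.instance Definition _ :=
  GRing.isSubmodClosed.Build _ _ left_invariant_field
    left_invariant_field_submod_closed.
HB.instance Definition _ := [SubChoice_isSubLmodule of lieAlg by <:].

Lemma commutator_left_invariant (X Y : lieAlg) :
  (fun f => X (Y f) - Y (X f)) \in left_invariant_field.
Proof.
have [lX dX iX] := lieAlgP X; have [lY dY iY] := lieAlgP Y.
have DX f h : X (f + h) = X f + X h by rewrite -[f]scale1r lX !scale1r.
have DY f h : Y (f + h) = Y f + Y h by rewrite -[f]scale1r lY !scale1r.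
apply/asboolP; split=> [a f h|f h|g f fg fgE p].
- rewrite lY lX lX lY scalerBr opprD.
  by rewrite !addrA; congr (_ + _); rewrite -!addrA; congr (_ + _); rewrite addrC.
- by rewrite dX dY DX DY !dX !dY; ring.
- by rewrite /= !fctE (iX _ _ _ (iY _ _ _ fgE)) (iY _ _ _ (iX _ _ _ fgE)).
Qed.

Definition lie_bracket (X Y : lieAlg) : lieAlg :=
  MkLieAlg (commutator_left_invariant X Y).

End LieAlgebra.

(* Left-invariant tensor fields and left-invariant connections on [G] are given
   by multilinear maps on the Lie algebra of left-invariant vector fields. *)
Section AlmostHermitian.
Context {R : realType} {E : normedModType R} {G : lieGroupType E}.

Local Notation g := (lieAlg G).
Implicit Types (J : g -> g) (ip : g -> g -> R) (nabla : g -> g -> g).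

Record is_inner_product ip : Prop := {
  ip_linear : forall (a : R) (X Y Z : g),
    ip (a *: X + Y) Z = a * ip X Z + ip Y Z;
  ip_sym : forall X Y : g, ip X Y = ip Y X;
  ip_pos : forall X : g, X != 0 -> 0 < ip X X }.

Record is_almost_hermitian J ip : Prop := {
  J_linear : linear J;
  J_square : forall X : g, J (J X) = - X;
  metric_inner_product : is_inner_product ip;
  J_isometry : forall X Y : g, ip (J X) (J Y) = ip X Y }.

Definition fundamental_form J ip (X Y : g) : R := ip (J X) Y.

Definition ext_deriv2 (w : g -> g -> R) (X Y Z : g) : R :=
  - w (lie_bracket X Y) Z - w (lie_bracket Y Z) X - w (lie_bracket Z X) Y.

(* [\sum_(i < j) (-1) ^ (i + j) b ([X_i, X_j], ...)], with the same normalization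
   as [ext_deriv2] *)
Definition ext_deriv3 (b : g -> g -> g -> R) (X Y Z W : g) : R :=
  - b (lie_bracket X Y) Z W + b (lie_bracket X Z) Y W
  - b (lie_bracket X W) Y Z - b (lie_bracket Y Z) X W
  + b (lie_bracket Y W) X Z - b (lie_bracket Z W) X Y.

Definition nijenhuis J (X Y : g) : g :=
  J (lie_bracket (J X) Y) + J (lie_bracket X (J Y)) + lie_bracket X Y
  - lie_bracket (J X) (J Y).

(* the (2,1) + (1,2) part of a 3-form *)
Definition plus_part J (eta : g -> g -> g -> R) (X Y Z : g) : R :=
  4^-1 * (3 * eta X Y Z + eta (J X) (J Y) Z + eta (J X) Y (J Z)
          + eta X (J Y) (J Z)).

Definition torsion nabla (X Y : g) : g :=
  nabla X Y - nabla Y X - lie_bracket X Y.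

Definition torsion_form ip nabla (X Y Z : g) : R := ip (torsion nabla X Y) Z.

Definition curvature nabla (X Y Z : g) : g :=
  nabla X (nabla Y Z) - nabla Y (nabla X Z) - nabla (lie_bracket X Y) Z.

Record is_gauduchon J ip (t : R) nabla : Prop := {
  gauduchon_linearl : forall Z : g, linear (nabla ^~ Z);
  gauduchon_linearr : forall X : g, linear (nabla X);
  gauduchon_metric : forall X Y Z : g,
    ip (nabla X Y) Z + ip Y (nabla X Z) = 0;
  gauduchon_torsion : forall X Y Z : g,
    let dwp := plus_part J (ext_deriv2 (fundamental_form J ip)) in
    torsion_form ip nabla X Y Z =
      - 4^-1 * ip (nijenhuis J X Y) Z
      - (t - 2) / 4 * dwp X Y (J Z)
      + (3 * t - 2) / 4 * dwp (J X) (J Y) (J Z) }.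

Definition flat_connection nabla : Prop :=
  forall X Y Z : g, curvature nabla X Y Z = 0.

Definition trivial_connection nabla : Prop := forall X Y : g, nabla X Y = 0.

Definition totally_skew (b : g -> g -> g -> R) : Prop :=
  forall X Y Z : g, b X Y Z = - b Y X Z /\ b X Y Z = - b X Z Y.

Definition closed3 (b : g -> g -> g -> R) : Prop :=
  forall X Y Z W : g, ext_deriv3 b X Y Z W = 0.

(* When [A] is abelian and [h] too, so is the Lie algebra of [H * A], and then the
   Gauduchon connections of all the left-invariant structures are trivial. *)
Definition abelian_subset (h : set g) : Prop :=
  forall X Y : g, h X -> h Y -> lie_bracket X Y = 0.

End AlmostHermitian.

Section Factors.
Context {R : realType} {E F : normedModType R}.
Context (H : lieGroupType E) (A : lieGroupType F).

(* The Lie algebras of the two factors, inside that of the product: the fields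
   tangent to a factor are those killed by the projection on the other one, i.e.
   those annihilating the functions of the other variable only. *)
Definition lie_factor1 : set (lieAlg (H * A)%type) :=
  [set X | forall f : Cinf (H * A)%type,
    (forall p q : H * A, p.2 = q.2 -> f p = f q) -> X f = 0].

Definition lie_factor2 : set (lieAlg (H * A)%type) :=
  [set X | forall f : Cinf (H * A)%type,
    (forall p q : H * A, p.1 = q.1 -> f p = f q) -> X f = 0].

Definition totally_real (J : lieAlg (H * A)%type -> lieAlg (H * A)%type) : Prop :=
  J @` lie_factor1 = lie_factor2.

End Factors.

Arguments lie_factor1 {R E F} H A.
Arguments lie_factor2 {R E F} H A.

(* Main.v *)
Require Import Defs.
From HB Require Import structures.
From mathcomp Require Import all_boot all_order all_algebra.
From mathcomp Require Import all_classical all_reals all_analysis.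
From mathcomp Require Import ring lra.

Set Implicit Arguments.
Unset Strict Implicit.
Unset Printing Implicit Defensive.

Import Order.TTheory GRing.Theory Num.Theory.
Import numFieldNormedType.Exports.

Local Open Scope classical_set_scope.
Local Open Scope ring_scope.

(** The Lie algebra of G = H x A is the sum of two ideals h and a, and a is
    central. As H is compact, h has an inner product for which every ad z is
    skew. A linear isomorphism from h to a carries it over to a, and J exchanges
    the two copies: writing X = (x, x') with both entries in the same Euclidean
    space,
      [X, Y] = ([x, y], 0),   J X = (- x', x),   <X, Y> = <x, y> + <x', y'>.
    The form c (x, y, z) = <[x, y], z> is then alternating, the exterior
    derivative of the fundamental form and the Nijenhuis tensor are sums of
    values of c, and comparing the coefficients shows that
      nabla^t_X Y = (2 - t) / 4 ([x, y], [x, y'])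
    has the required torsion. It is a metric connection because c is
    alternating, and a metric connection is determined by its torsion. For t = 2
    the factor vanishes, and the torsion form is - c, which is closed by the
    Jacobi identity. For t = -2 the factor is 1, and X |-> nabla_X is two copies
    of the adjoint representation composed with the projection to h, hence flat;
    it vanishes only if h is abelian.

    It remains to obtain this description of the Lie algebra from its definition
    by left-invariant derivations of smooth functions.

    - A derivation at a point is a directional derivative in a chart
      ([point_derivation]). This rests on Hadamard's lemma ([hadamard]): a smooth
      f is f p + \sum_i (x_i - p_i) h_i with smooth h_i, namely the averages
      along rays of the partial derivatives of f. Cutoff functions turn this local
      identity into a global one. Consequently the Lie algebra is isomorphic to
      the model space ([tangent_inj], [tangent_surj]).
    - The fields on H x A correspond to the pairs of fields on H and A
      ([proj_inj], [proj_surj]), and the bracket is computed componentwise.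
    - If A is abelian, inversion is an automorphism acting as - 1 on the Lie
      algebra, so [X, Y] = [- X, - Y] is equal to its opposite
      ([lie_bracket_abelian]).
    - The matrices of the adjoint action of a compact group are bounded, and a
      bounded group of matrices preserves an inner product ([invariant_form]).
      Instead of averaging over the group, one minimises the largest Frobenius
      norm of a form along its orbit: by the parallelogram identity the minimiser
      is unique, hence invariant. Differentiating the invariance makes ad skew
      ([adj_smooth], [invariant_metric]). *)

(** * Model spaces with finitely many coordinates *)

(** A spanning family with continuous linear coefficients: what it takes to expand
    a derivative on partial derivatives. The index type is arbitrary so that a
    product is indexed by a disjoint sum. *)
Class frame {R : realType} (E : normedModType R) := Frame {
  frame_idx : finType;
  frame_vec : frame_idx -> E;
  frame_co : frame_idx -> {linear E -> R^o};
  frame_co_continuous : forall i, continuous (frame_co i);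
  frameE : forall v, v = \sum_i frame_co i v *: frame_vec i }.

Section FrameInstances.
Context {R : realType}.

#[global, program] Instance frame_real : frame R^o :=
  @Frame R R^o unit (fun=> 1) (fun=> idfun) _ _.
Next Obligation. by move=> i x; apply: cvg_id. Qed.
Next Obligation.
by move=> v; rewrite (big_pred1 tt) ?[RHS]mulr1//; case.
Qed.

Definition rV_coord n (i : 'I_n) (v : 'rV[R]_n) : R^o := v ord0 i.

Fact rV_coord_linear n (i : 'I_n) : linear (rV_coord i).
Proof. by move=> a u v; rewrite /rV_coord !mxE. Qed.
HB.instance Definition _ n i :=
  GRing.isLinear.Build _ _ _ _ _ (@rV_coord_linear n i).

#[global, program] Instance frame_rV n : frame 'rV[R]_n :=
  @Frame R 'rV[R]_n 'I_n (fun i => delta_mx 0 i)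
  (fun i => rV_coord i) _ _.
Next Obligation. by move=> n i v; apply: coord_continuous. Qed.
Next Obligation. by move=> n v; exact: row_sum_delta. Qed.

Section Pair.
Context {E F : normedModType R} (frE : frame E) (frF : frame F).

Definition pair_co (i : @frame_idx _ _ frE + @frame_idx _ _ frF)
    (v : (E * F)%type) : R^o :=
  match i with inl i => frame_co i v.1 | inr j => frame_co j v.2 end.

Fact pair_co_linear i : linear (pair_co i).
Proof. by case: i => i a [u u'] [v v'] /=; rewrite linearP. Qed.
HB.instance Definition _ i :=
  GRing.isLinear.Build _ _ _ _ _ (pair_co_linear i).

#[global, program] Instance frame_pair : frame (E * F)%type :=
  @Frame R (E * F)%type (@frame_idx _ _ frE + @frame_idx _ _ frF)%type
  (fun i => match i with inl i => (frame_vec i, 0) | inr j => (0, frame_vec j)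
            end)
  (fun i => pair_co i) _ _.
Next Obligation.
move=> [i|j] v.
  by apply: (@cvg_comp _ _ _ fst (frame_co i));
    [exact: cvg_fst|exact: frame_co_continuous].
by apply: (@cvg_comp _ _ _ snd (frame_co j));
  [exact: cvg_snd|exact: frame_co_continuous].
Qed.
Next Obligation.
move=> [u v]; rewrite big_sumType /= {1}(frameE u) {1}(frameE v).
have fstE I (r : seq I) (h : I -> E) :
    \sum_(i <- r) (h i, 0 : F) = (\sum_(i <- r) h i, 0).
  elim/big_rec2: _ => // i x _ _ ->.
  by congr (_, _); rewrite addr0.
have sndE I (r : seq I) (h : I -> F) :
    \sum_(i <- r) (0 : E, h i) = (0, \sum_(i <- r) h i).
  elim/big_rec2: _ => // i x _ _ ->.
  by congr (_, _); rewrite addr0.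
have zE (a : R) (w : E) : a *: (w, 0 : F) = (a *: w, 0).
  by congr (_, _); rewrite scaler0.
have zF (a : R) (w : F) : a *: (0 : E, w) = (0, a *: w).
  by congr (_, _); rewrite scaler0.
under eq_bigr do rewrite zE.
under [X in _ = _ + X]eq_bigr do rewrite zF.
by rewrite fstE sndE; congr (_, _); rewrite ?addr0 ?add0r.
Qed.

End Pair.
End FrameInstances.

Section FrameTheory.
Context {R : realType} {E : normedModType R} {frE : frame E}.

Lemma frame_linear_continuous (F : normedModType R) (L : {linear E -> F}) :
  continuous L.
Proof.
have -> : L = (fun v => \sum_i frame_co i v *: L (frame_vec i)) :> (E -> F).
  by apply/funext => v; rewrite {1}(frameE v) linear_sum;
    apply: eq_bigr => i _; rewrite linearZ.
apply: continuous_big => [|i _ v]; first exact: add_continuous.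
by apply: cvgZr_tmp; exact: frame_co_continuous.
Qed.

Lemma frame_co_bounded :
  exists2 C : R, 0 < C & forall v, \sum_i `|frame_co i v| <= C * `|v|.
Proof.
have H i : exists C : R, 0 < C /\ forall v, `|frame_co i v| <= C * `|v|.
  have [C C0 HC] := linear_lipschitz (@frame_co_continuous _ _ frE i).
  by exists C.
have {}[C HC] := choice H; exists (1 + \sum_i C i).
  by rewrite ltr_wpDr // sumr_ge0 // => i _; apply/ltW/(HC i).1.
move=> v; rewrite mulrDl mulr_suml mul1r ler_wpDl //.
by apply: ler_sum => i _; exact: (HC i).2.
Qed.

End FrameTheory.

(** * The chain rule in class C^k *)
Section Chain.
Context {R : realType}.
Implicit Types E F : normedModType R.

Lemma Ck_sub E F k (U V : set E) (f : E -> F) :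
  V `<=` U -> Ck k U f -> Ck k V f.
Proof.
move=> VU; elim: k f => [|k IH] f /=; first by move=> cf x /VU /cf.
by move=> [df Df]; split=> [x /VU /df //|v]; exact/IH/Df.
Qed.

Lemma Ck_local E F k (U : set E) (f : E -> F) :
  (forall x, U x -> exists2 V : set E, V x & Ck k V f) -> Ck k U f.
Proof.
elim: k f => [|k IH] f /= locf.
  by move=> x /locf[V Vx]; apply.
split=> [x /locf[V Vx [df _]]|v]; first exact: df.
by apply: IH => x /locf[V Vx [_ Df]]; exists V.
Qed.

Lemma derive_comp E F F' (f : E -> F) (g : F -> F') x v :
  differentiable f x -> differentiable g (f x) ->
  'D_v (g \o f) x = 'D_('D_v f x) g (f x).
Proof.
move=> df dg; rewrite !deriveE//; last exact: differentiable_comp.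
by rewrite diff_comp.
Qed.

Lemma derive_linear E F (L : {linear E -> F}) x v : 'D_v L x = L v.
Proof.
rewrite /derive; apply: cvg_lim => //; apply: cvg_near_cst.
near=> h; have h0 : h != 0 by near: h; exact: nbhs_dnbhs_neq.
have LE : (L \o shift x) (h *: v) - L x = h *: L v.
  by rewrite /= linearD addrK linearZ.
by rewrite [X in _ *: X]LE scalerA mulVf// scale1r.
Unshelve. all: by end_near. Qed.

Lemma Ck_linear_post E F F' k (U : set E) (L : {linear F -> F'}) (f : E -> F) :
  open U -> continuous L -> Ck k U f -> Ck k U (L \o f).
Proof.
move=> oU cL; elim: k f => [|k IH] f /= => [cf x Ux|[df Df]].
  by apply: continuous_comp; [apply: cf|apply: cL].
have dL y : differentiable L y by apply: linear_differentiable.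
split=> [x Ux|v]; first by apply: differentiable_comp => //; apply: df.
apply: eq_Ck (IH _ (Df v)) => // x Ux /=.
by rewrite derive_comp ?derive_linear//; exact: df.
Qed.

Lemma Ck_sum E F k (U : set E) (I : Type) (r : seq I) (f : I -> E -> F) :
  open U -> (forall i, Ck k U (f i)) -> Ck k U (fun x => \sum_(i <- r) f i x).
Proof.
move=> oU Cf; elim: r => [|i r IH].
  by apply: eq_Ck (@Ck_cst _ _ _ k U 0) => // x _; rewrite big_nil.
by apply: eq_Ck (CkD oU (Cf i) IH) => // x _; rewrite big_cons.
Qed.

Lemma Ck_scale E F k (U : set E) (a : E -> R^o) (w : F) :
  open U -> Ck k U a -> Ck k U (fun x => a x *: w).
Proof.
move=> oU Ca.
have lin : linear (fun b : R^o => b *: w).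
  by move=> b x y; rewrite scalerDl scalerA.
pose L : {linear R^o -> F} := HB.pack (fun b : R^o => b *: w)
  (GRing.isLinear.Build _ _ _ _ _ lin).
exact: (@Ck_linear_post _ _ _ _ _ L a oU (@frame_linear_continuous _ _ _ _ L)).
Qed.

Lemma Ck_frame E F {frF : frame F} k (U : set E) (f : E -> F) :
  open U -> (forall i, Ck k U (frame_co i \o f : E -> R^o)) -> Ck k U f.
Proof.
move=> oU Cf; apply: eq_Ck (Ck_sum (index_enum (@frame_idx _ _ frF)) oU
    (fun i => Ck_scale (frame_vec i) oU (Cf i))) => // x _.
by rewrite [RHS]frameE.
Qed.

Lemma derive_frame E F {frE : frame E} (f : E -> F) x v :
  differentiable f x -> 'D_v f x = \sum_i frame_co i v *: 'D_(frame_vec i) f x.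
Proof.
move=> df; rewrite deriveE// [v in LHS]frameE linear_sum; apply: eq_bigr => i _.
by rewrite linearZ deriveE.
Qed.

(** By induction on k, from
    'D_v (g \o f) x = \sum_i (i-th coordinate of 'D_v f x) * 'D_(e_i) g (f x):
    the directional derivatives that define class C^k become products of
    functions of class C^(k - 1) once the direction 'D_v f x, which varies with x,
    is expanded on fixed vectors. *)
Lemma Ck_comp_real E F {frF : frame F} k (U : set E) (V : set F)
    (f : E -> F) (g : F -> R^o) :
  open U -> (forall x, U x -> V (f x)) ->
  Ck k U f -> Ck k V g -> Ck k U (g \o f).
Proof.
move=> oU; elim: k f g => [|k IH] f g UV => [cf cg x Ux|cf cg].
  by apply: continuous_comp; [apply: cf|apply/cg/UV].
have [df Df] := cf; have [dg Dg] := cg.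
split=> [x Ux|v].
  by apply: differentiable_comp; [apply: df|apply/dg/UV].
have Dgf i :
    Ck k U ((frame_co i \o 'D_v f) \* ('D_(frame_vec i) g \o f) : E -> R^o).
  apply: CkM => //; last exact: IH UV (Ck_le cf) (Dg _).
  apply: Ck_linear_post => //; [exact: frame_linear_continuous|exact: Df].
have := Ck_sum (index_enum (@frame_idx _ _ frF)) oU Dgf.
apply: eq_Ck => // x Ux; rewrite [RHS]derive_comp; [|exact: df|exact/dg/UV].
by rewrite derive_frame //; exact/dg/UV.
Qed.

Lemma Ck_comp E F F' {frF : frame F} {frF' : frame F'} k (U : set E)
    (V : set F) (f : E -> F) (g : F -> F') :
  open U -> open V -> (forall x, U x -> V (f x)) ->
  Ck k U f -> Ck k V g -> Ck k U (g \o f).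
Proof.
move=> oU oV UV Cf Cg; apply: Ck_frame => // i.
apply: (@Ck_comp_real _ _ _ k U V f (frame_co i \o g)) => //.
by apply: Ck_linear_post => //; exact: frame_linear_continuous.
Qed.

Lemma Ck_lin E F {frE : frame E} k (U : set E) (L : {linear E -> F}) :
  Ck k U L.
Proof.
case: k => [|k] /=; first by move=> x _; apply: frame_linear_continuous.
split=> [x _|v]; first exact/linear_differentiable/frame_linear_continuous.
have -> : 'D_v L = cst (L v) by apply/funext => x; rewrite derive_linear.
exact: Ck_cst.
Qed.

Lemma Ck_id E {frE : frame E} k (U : set E) : Ck k U id.
Proof. exact: (@Ck_lin _ _ _ k U idfun). Qed.

End Chain.

(** * Cutoff functions *)
Section Bump.
Context {R : realType}.

(** The functions x^(- j) exp (- 1 / x), extended by 0 to x <= 0. The whole family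
    is needed since its span is stable under derivation. *)
Definition expinv (j : nat) (x : R) : R :=
  if 0 < x then x^-1 ^+ j * expR (- x^-1) else 0.

Lemma expinv_ge0 j x : 0 <= expinv j x.
Proof.
rewrite /expinv; case: ifP => // x0.
by rewrite mulr_ge0 ?expR_ge0 ?exprn_ge0 ?invr_ge0 ?ltW.
Qed.

Lemma expinv_gt0 j x : 0 < x -> 0 < expinv j x.
Proof.
by move=> x0; rewrite /expinv x0 mulr_gt0 ?expR_gt0 ?exprn_gt0 ?invr_gt0.
Qed.

Lemma expinv_eq0 j x : x <= 0 -> expinv j x = 0.
Proof. by move=> x0; rewrite /expinv ltNge x0. Qed.

Lemma expinvS j x : expinv j x = x * expinv j.+1 x.
Proof.
rewrite /expinv; case: ifP => [x0|_]; last by rewrite mulr0.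
by rewrite exprS !mulrA divff ?mul1r// gt_eqF.
Qed.

(** From exp y >= y^(j + 1) / (j + 1)! at y = 1 / x. Together with [expinvS] this
    gives both the continuity and the derivative at 0. *)
Lemma expinv_le j x : `|expinv j x| <= (j.+1)`!%:R * `|x|.
Proof.
rewrite ger0_norm ?expinv_ge0//; have [x0|x0] := leP x 0.
  by rewrite expinv_eq0// mulr_ge0// ler0n.
rewrite (gtr0_norm x0) /expinv x0 expRN ler_pdivrMr ?expR_gt0//.
have y0 : 0 <= x^-1 by rewrite invr_ge0 ltW.
have := expR_ge1Dxn j y0 => /(le_trans _) H.
have {}H : x^-1 ^+ j.+1 / j.+1`!%:R <= expR x^-1.
  by apply: H; rewrite lerDr.
rewrite ler_pdivrMr ?ltr0n ?fact_gt0// in H.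
rewrite -mulrA [x * _]mulrC mulrA -ler_pdivrMr//.
by rewrite mulrC -exprS mulrC.
Qed.

Lemma is_derive_expinv j (x : R) :
  is_derive x 1 (expinv j) (expinv j.+2 x - j%:R * expinv j.+1 x).
Proof.
have [x0|x0|->] := ltgtP x 0.
- rewrite !expinv_eq0 ?ltW// mulr0 subr0.
  apply: (@near_eq_is_derive _ _ _ (cst 0)).
  have := lt_nbhsl x0; apply: filterS => y y0; rewrite expinv_eq0//; exact: ltW.
- have xn0 : x != 0 by rewrite gt_eqF.
  have dV : is_derive x 1 (fun y : R => y^-1) (- x ^- 2 *: 1).
    exact: (@is_deriveV _ id).
  have D : is_derive x 1
      (((fun y => y^-1) ^+ j) * (expR \o (- (fun y => y^-1))))
      (expinv j.+2 x - j%:R * expinv j.+1 x).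
    apply: is_derive_eq; rewrite /expinv x0 /= !fctE /GRing.scale /=.
    rewrite -exprVn; case: j => [|j] /=; first by ring.
    by rewrite !exprS; ring.
  apply: near_eq_is_derive D.
  have := lt_nbhsr x0; apply: filterS => y y0.
  by rewrite /expinv y0 !fctE.
- rewrite !expinv_eq0// mulr0 subr0.
  have cvg0 : (fun h => h^-1 *: (expinv j (h *: 1 + 0) - expinv j 0)) @ 0^' --> (0 : R).
    apply/cvgr0Pnorm_le => e e0.
    have d0 : 0 < e / (j.+2)`!%:R by rewrite divr_gt0// ltr0n fact_gt0.
    near=> h.
    have h0 : h != 0 by near: h; exact: nbhs_dnbhs_neq.
    rewrite addr0 (expinv_eq0 _ (lexx 0)) subr0 [h *: 1]mulr1 expinvS.
    rewrite /GRing.scale /= mulrA mulVf// mul1r.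
    apply: le_trans (expinv_le _ _) _.
    rewrite mulrC -ler_pdivlMr ?ltr0n ?fact_gt0//.
    by near: h; apply: nbhs_dnbhs; exists (e / (j.+2)`!%:R) => //= y /=; rewrite sub0r normrN => /ltW.
  by apply: DeriveDef; [apply/cvg_ex; exists 0|exact: cvg_lim cvg0].
Unshelve. all: by end_near. Qed.

Lemma Ck_expinv k j : Ck k setT (expinv j : R^o -> R^o).
Proof.
elim: k j => [|k IH] j.
  move=> x _; apply: differentiable_continuous; apply/derivable1_diffP.
  by have [] := is_derive_expinv j x.
split=> [x _|v].
  by apply/derivable1_diffP; have [] := is_derive_expinv j x.
have C1 := Ck_scale (1 : R^o) openT (IH j.+2).
have C2 := Ck_scale (- j%:R : R^o) openT (IH j.+1).
have C := Ck_scale v openT (CkD openT C1 C2).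
apply: (eq_Ck openT) C => x _ /=.
have [dv dvE] := is_derive_expinv j x.
have df : differentiable (expinv j : R^o -> R^o) x by apply/derivable1_diffP.
rewrite [RHS]deriveE// -[v in RHS]mulr1 [_ 'd _ _ _]linearZ /=.
rewrite -[X in _ = _ *: X]deriveE// dvE /GRing.scale /=; ring.
Qed.

End Bump.

Section Cutoff.
Context {R : realType} {E : normedModType R} {frE : frame E}.

Lemma Ck_prod k (U : set E) (I : Type) (r : seq I) (f : I -> E -> R^o) :
  open U -> (forall i, Ck k U (f i)) ->
  Ck k U (fun x => \prod_(i <- r) f i x : R^o).
Proof.
move=> oU Cf; elim: r => [|i r IH].
  by apply: (eq_Ck oU) (@Ck_cst _ _ R^o k U 1) => // x _; rewrite big_nil.
by apply: (eq_Ck oU) (CkM oU (Cf i) IH) => // x _; rewrite big_cons.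
Qed.

(** A product over the coordinates of one-variable bump functions, supported in a
    box; the box is compact as a linear image of a box of row vectors. *)
Lemma cutoff_exists (p : E) (e : R) : 0 < e ->
  exists (chi : E -> R^o) (K : set E), [/\ smooth_on setT chi, chi p = 1,
    compact K, K `<=` ball p e & forall x, ~ K x -> chi x = 0].
Proof.
move=> e0; set I := @frame_idx _ _ frE.
pose S := \sum_i `|@frame_vec _ _ frE i|.
have S0 : 0 <= S by rewrite sumr_ge0.
(* A point with all its coordinates at most r is at distance at most r * S. *)
pose r := e / (S + 1); have S1 : 0 < S + 1 by rewrite ltr_wpDl.
have r0 : 0 < r by rewrite divr_gt0.
pose box := [set u : 'rV[R]_#|I| | forall j, `[- r, r]%classic (u ord0 j)].
pose M (u : 'rV[R]_#|I|) := \sum_(i : I) u ord0 (enum_rank i) *: frame_vec i.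
have linM : linear M.
  move=> a u v; rewrite /M scaler_sumr -big_split; apply: eq_bigr => i _ /=.
  by rewrite !mxE scalerDl scalerA.
pose M' : {linear 'rV[R]_#|I| -> E} := HB.pack M
  (GRing.isLinear.Build _ _ _ _ _ linM).
pose L u := p + M u.
pose q (i : I) (x : E) : R^o := r ^+ 2 - (frame_co i x - frame_co i p) ^+ 2.
have qp i : q i p = r ^+ 2 by rewrite /q subrr expr0n subr0.
have Cq k i : Ck k setT (q i).
  have C1 : Ck k setT (fun x => frame_co i x - frame_co i p : R^o).
    by apply: (CkD openT) => //; [exact: Ck_lin|exact: Ck_cst].
  have C2 := Ck_scale (-1 : R^o) openT (CkM openT C1 C1).
  apply: (eq_Ck openT) (CkD openT (Ck_cst k setT (r ^+ 2 : R^o)) C2) => x _ /=.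
  by rewrite /q expr2 [_ *: _]mulrN mulr1.
pose c := expinv 0 (r ^+ 2).
have c0 : 0 < c by rewrite expinv_gt0// exprn_gt0.
exists (fun x => \prod_i ((expinv 0 (q i x) : R^o) *: (c^-1 : R^o)) : R^o), (L @` box).
split.
- move=> k; apply: (Ck_prod _ openT) => i; apply: (Ck_scale _ openT).
  apply: (@Ck_comp_real _ _ R^o frame_real k setT setT (q i) (expinv 0)) => //.
    exact: openT.
  exact: Ck_expinv.
- by rewrite big1// => i _; rewrite qp /GRing.scale /= divff// gt_eqF.
- apply: continuous_compact.
    apply: continuous_subspaceT => u.
    apply: (@continuousD _ _ _ (cst p) M); first exact: cst_continuous.
    exact: (@frame_linear_continuous _ _ _ _ M').
  by apply: (@rV_compact _ _ (fun=> `[- r, r]%classic)) => i; exact: segment_compact.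
- move=> _ [u bu <-]; rewrite /L /M -ball_normE /= opprD addrA subrr sub0r normrN.
  apply: le_lt_trans (ler_norm_sum _ _ _) _.
  apply: (@le_lt_trans _ _ (r * S)); last first.
    by rewrite /r mulrAC ltr_pdivrMr// ltr_pM2l// ltrDl.
  rewrite /S mulr_sumr; apply: ler_sum => i _; rewrite normrZ ler_wpM2r//.
  by rewrite ler_norml; have := bu (enum_rank i); rewrite /= in_itv.
- move=> x nK; apply: contrapT => n0; apply: nK.
  exists (\row_j (frame_co (enum_val j) x - frame_co (enum_val j) p)).
    move=> j; rewrite mxE /= in_itv /=; set i := enum_val j.
    rewrite -ler_norml -ler_sqr ?nnegrE ?(ltW r0)// real_normK ?num_real//.
    rewrite leNgt; apply/negP => lt; apply: n0; rewrite (bigD1 i)//=.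
    rewrite expinv_eq0; first by rewrite scale0r mul0r.
    by rewrite /q subr_le0 ltW.
  rewrite /L /M; under eq_bigr do rewrite mxE enum_rankK.
  rewrite -[RHS](subrKC p); congr (_ + _); rewrite [RHS]frameE.
  by apply: eq_bigr => i _; rewrite linearB.
Qed.

End Cutoff.

(** * Averages along rays and Hadamard's lemma *)
Section UnitInterval.
Context {R : realType}.
Implicit Types f g : R -> R.

Definition int01 g : R := \int[lebesgue_measure]_(s in `[0%R, 1%R]) g s.

Definition continuous01 g := forall s : R, 0 <= s <= 1 -> {for s, continuous g}.

Lemma continuous01_cst c : continuous01 (fun=> c).
Proof. by move=> s _; exact: cst_continuous. Qed.

Lemma continuous01D f g : continuous01 f -> continuous01 g ->
  continuous01 (fun s => f s + g s).
Proof. by move=> cf cg s s01; apply: continuousD; [exact: cf|exact: cg]. Qed.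

Lemma continuous01M f g : continuous01 f -> continuous01 g ->
  continuous01 (fun s => f s * g s).
Proof. by move=> cf cg s s01; apply: continuousM; [exact: cf|exact: cg]. Qed.

Lemma continuous01_within g :
  continuous01 g -> {within `[0, 1], continuous g}.
Proof.
move=> cg; apply: continuous_in_subspaceT => s; rewrite inE /= in_itv /=.
exact: cg.
Qed.

Lemma integrable01 g : continuous01 g ->
  lebesgue_measure.-integrable `[0%R, 1%R] (EFin \o g).
Proof.
move=> cg; apply: continuous_compact_integrable; first exact: segment_compact.
exact: continuous01_within.
Qed.

Lemma eq_int01 f g : (forall s, 0 <= s <= 1 -> f s = g s) -> int01 f = int01 g.
Proof.
by move=> fg; apply: eq_Rintegral => s; rewrite inE /= in_itv /=; exact: fg.
Qed.

Lemma int01_linear a f g : continuous01 f -> continuous01 g ->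
  int01 (fun s => a * f s + g s) = a * int01 f + int01 g.
Proof.
move=> cf cg; have caf : continuous01 (fun s => a * f s).
  by apply: continuous01M => //; exact: continuous01_cst.
rewrite /int01 RintegralD//; [|exact: integrable01..].
by rewrite RintegralZl//; exact: integrable01.
Qed.

Lemma int01_cst c : int01 (fun=> c) = c.
Proof.
rewrite /int01 Rintegral_cst//= lebesgue_measure_itv /= lte_fin ltr01.
by rewrite -EFinB subr0 /= mulr1.
Qed.

Lemma int01_norm_le g c : continuous01 g ->
  (forall s, 0 <= s <= 1 -> `|g s| <= c) -> `|int01 g| <= c.
Proof.
move=> cg gc; have cn : continuous01 (fun s => `|g s|).
  by move=> s s01; apply: continuous_comp; [exact: cg|exact: norm_continuous].
apply: (le_trans (le_normr_Rintegral _ (integrable01 cg))) => //.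
rewrite -[leRHS]int01_cst; apply: le_Rintegral => //; try exact: integrable01.
exact/integrable01/continuous01_cst.
Qed.

Lemma int01_FTC f g : (forall s : R, 0 <= s <= 1 -> is_derive s 1 f (g s)) ->
  continuous01 g -> int01 g = f 1 - f 0.
Proof.
move=> fg cg; have df (s : R) : 0 <= s <= 1 -> derivable f s 1.
  by move=> /fg[].
have cf (s : R) : 0 <= s <= 1 -> {for s, continuous f}.
  by move=> /df/derivable1_diffP/differentiable_continuous.
rewrite /int01 /Rintegral (@continuous_FTC2 _ _ f)//=.
- exact: continuous01_within.
- split.
  + by move=> s; rewrite in_itv /= => /andP[s0 s1]; apply: df; rewrite !ltW.
  + by apply: cvg_at_right_filter; apply: cf; rewrite lexx ler01.
  + by apply: cvg_at_left_filter; apply: cf; rewrite lexx ler01.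
- move=> s; rewrite in_itv /= => /andP[s0 s1].
  by rewrite derive1E; have [|_ ->//] := fg s; rewrite !ltW.
Qed.

End UnitInterval.

Section RayAverage.
Context {R : realType} {E : normedModType R} {frE : frame E}.

Lemma differentiable_estimate (F : normedModType R) (f : E -> F)
    (L : {linear E -> F}) x :
  (forall e : R, 0 < e ->
     \forall v \near 0, `|f (v + x) - f x - L v| <= e * `|v|) ->
  differentiable f x /\ forall v, 'D_v f x = L v.
Proof.
move=> est; have E0 : f \o shift x = cst (f x) + L +o_ 0 id.
  apply/eqaddoP => e e0; apply: filterS (est _ e0) => v.
  by rewrite !fctE /= opprD addrA.
have cL : continuous L by apply: frame_linear_continuous.
have dfL := diff_unique cL E0.
have df : differentiable f x by apply/diff_locallyP; rewrite dfL; split.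
by split=> // v; rewrite deriveE// dfL.
Qed.

Lemma is_derive_line (F : normedModType R) (f : E -> F) (a v : E) (t : R) :
  differentiable f (a + t *: v) ->
  is_derive t 1 (fun s => f (a + s *: v)) ('D_v f (a + t *: v)).
Proof.
move=> df; have dv : derivable f (a + t *: v) v by apply: diff_derivable.
have lineE : (fun h : R => h^-1 *: (((fun s => f (a + s *: v)) \o shift t) (h *: 1)
      - f (a + t *: v))) =
    (fun h : R => h^-1 *: ((f \o shift (a + t *: v)) (h *: v) - f (a + t *: v))).
  apply/funext => h /=; congr (_ *: (f _ - _)).
  by rewrite [h *: 1]mulr1 scalerDl addrCA.
by split; rewrite /derivable /derive lineE.
Qed.

Lemma ball_convex (x : E) (e : R) y z t : ball x e y -> ball x e z ->
  0 <= t <= 1 -> ball x e (y + t *: (z - y)).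
Proof.
rewrite -ball_normE /= => yx zx /andP[t0 t1].
have -> : x - (y + t *: (z - y)) = (1 - t) *: (x - y) + t *: (x - z).
  have -> : z - y = (x - y) - (x - z) by rewrite opprB [RHS]addrC subrKA.
  rewrite opprD addrA [t *: (_ - _)]scalerBr opprB scalerBl scale1r.
  by rewrite -[RHS]addrA [- _ + _ in RHS]addrC.
apply: le_lt_trans (ler_normD _ _) _; rewrite !normrZ.
rewrite (ger0_norm t0) ger0_norm ?subr_ge0//.
have [->|tn0] := eqVneq t 0; first by rewrite mul0r addr0 subr0 mul1r.
have tp : 0 < t by rewrite lt_def tn0.
have -> : e = (1 - t) * e + t * e by rewrite -mulrDl subrK mul1r.
by rewrite ler_ltD ?ltr_pM2l// ler_wpM2l ?subr_ge0// ltW.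
Qed.

(** The mean value theorem on the segment from y to z, with the derivative along
    z - y expanded on the frame, so that the continuity of finitely many partial
    derivatives at x bounds the error uniformly in the direction. The uniformity
    in both y and z is what differentiation under the integral sign requires. *)
Lemma strictly_differentiable (U : set E) (f : E -> R^o) x (e : R) :
  open U -> Ck 1 U f -> U x -> 0 < e ->
  \forall y \near x & z \near x,
    `|f z - f y - 'D_(z - y) f y| <= e * `|z - y|.
Proof.
move=> oU [df cD] Ux e0.
have [C C0 HC] := @frame_co_bounded _ _ frE.
have d0 : 0 < e / C / 2 by rewrite !divr_gt0.
have near_i i : \forall w \near x,
    `|'D_(frame_vec i) f x - 'D_(frame_vec i) f w| <= e / C / 2.
  by have /cvgrPdist_le := cD (frame_vec i) x Ux; apply.
have /nbhs_ballP[r /= r0 Br] : \forall w \near x, U w /\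
    forall i, `|'D_(frame_vec i) f x - 'D_(frame_vec i) f w| <= e / C / 2.
  apply: filterI; first exact: open_nbhs_nbhs.
  exact: filter_forall.
exists (ball x r, ball x r) => /=.
  by split; apply: nbhsx_ballx.
move=> [y z] [/= By Bz].
have Bt (t : R) : 0 <= t <= 1 -> ball x r (y + t *: (z - y)) by apply: ball_convex.
have dl (t : R) : 0 <= t <= 1 -> is_derive t 1 (fun s => f (y + s *: (z - y)))
    ('D_(z - y) f (y + t *: (z - y))).
  by move=> /Bt /Br[Uw _]; apply/is_derive_line/df.
have [t t01] : exists2 t : R, t \in `[0, 1]%R &
    f (y + 1 *: (z - y)) - f (y + 0 *: (z - y)) =
    'D_(z - y) f (y + t *: (z - y)) * (1 - 0).
  apply: (@MVT_segment R (fun s => f (y + s *: (z - y)))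
    (fun s => 'D_(z - y) f (y + s *: (z - y)))) => //.
    by move=> t; rewrite in_itv /= => /andP[? ?]; apply: dl; rewrite !ltW.
  apply: continuous_in_subspaceT => t; rewrite inE /= in_itv /= => /dl[+ _].
  by move=> /derivable1_diffP/differentiable_continuous.
rewrite in_itv /= in t01; rewrite scale1r scale0r addr0 subrKC subr0 mulr1 => ->.
have [Uw Hw] := Br _ (Bt _ t01); have [Uy Hy] := Br _ By.
rewrite (derive_frame _ (df _ Uw)) (derive_frame _ (df _ Uy)) -sumrB.
under eq_bigr do rewrite -scalerBr.
apply: le_trans (ler_norm_sum _ _ _) _.
apply: (@le_trans _ _ ((\sum_i `|frame_co i (z - y)|) * (e / C))); last first.
  rewrite mulrA ler_pdivrMr// mulrC -mulrA ler_pM2l// mulrC; exact: HC.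
rewrite mulr_suml; apply: ler_sum => i _; rewrite normrZ ler_wpM2l//.
rewrite -(subrKA ('D_(frame_vec i) f x)) [e / C]splitr.
apply: le_trans (ler_normD _ _) _; apply: lerD; last exact: Hy.
by rewrite distrC; exact: Hw.
Qed.

End RayAverage.

Section Hadamard.
Context {R : realType} {E : normedModType R} {frE : frame E}.
Variables (p : E) (e : R).
Hypothesis e0 : 0 < e.
Local Notation U := (ball p e).

Lemma ray_ball x s : U x -> 0 <= s <= 1 -> U (p + s *: (x - p)).
Proof. by apply: ball_convex; exact: ballxx. Qed.

(** The weight s^j is there because differentiating s |-> G (p + s (x - p)) with
    respect to x produces a factor s. *)
Definition ray_average (j : nat) (G : E -> R^o) (x : E) : R^o :=
  int01 (fun s => s ^+ j * G (p + s *: (x - p))).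

Lemma continuous_line (a v : E) : continuous (fun s : R => a + s *: v).
Proof.
move=> s; apply: cvgD; first exact: cvg_cst.
by apply: cvgZr_tmp; exact: cvg_id.
Qed.

Lemma ray_continuous j (G : E -> R^o) x :
  (forall y, U y -> {for y, continuous G}) -> U x ->
  continuous01 (fun s => s ^+ j * G (p + s *: (x - p))).
Proof.
move=> cG Ux; apply: continuous01M; first by move=> s _; exact: exprn_continuous.
move=> s s01; apply: (@continuous_comp _ _ _ (fun s : R => p + s *: (x - p)) G).
  exact: continuous_line.
exact/cG/ray_ball.
Qed.

(** Differentiation under the integral sign. The difference quotients converge
    uniformly in s: strict differentiability gives the estimate near each point of
    the segment from p to x, and the compactness of [0, 1] makes it hold for all s
    at once. *)
Lemma ray_average_diff j (G : E -> R^o) x : Ck 1 U G -> U x ->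
  differentiable (ray_average j G) x /\
  forall v, 'D_v (ray_average j G) x = ray_average j.+1 ('D_v G) x.
Proof.
move=> CG Ux; have [dG cDG] := CG.
have cG y : U y -> {for y, continuous G} by apply: (Ck_continuous CG).
have oU : open U by apply: ball_open.
have cD w : continuous01 (fun s => s ^+ j.+1 * 'D_w G (p + s *: (x - p))).
  exact: ray_continuous (cDG w) Ux.
pose L0 v : R^o := ray_average j.+1 ('D_v G) x.
have linL : linear L0.
  move=> a u v; rewrite /L0 /ray_average.
  rewrite -[RHS]/(a * int01 _ + int01 _) -int01_linear//.
  apply: eq_int01 => s s01; have dGs := dG _ (ray_ball Ux s01).
  by rewrite !deriveE// linearP mulrDr /GRing.scale /= mulrCA.
pose L : {linear E -> R^o} := HB.pack L0
  (GRing.isLinear.Build _ _ _ _ _ linL).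
apply: (@differentiable_estimate _ _ _ _ _ L) => eps eps0.
(* The tube lemma for [0, 1]: the estimate holds for all s and all small v. *)
have tube : \forall v \near (0 : E), forall s : R, `[0, 1]%classic s ->
   `|G (p + s *: (v + x - p)) - G (p + s *: (x - p)) -
     'D_(s *: v) G (p + s *: (x - p))| <= eps * `|s *: v|.
  have /compact_near_coveringP := @segment_compact R 0 1.
  apply => s0; rewrite /= in_itv /= => s01.
  have [[A B] [/= nA nB] AB] := strictly_differentiable oU CG (ray_ball Ux s01) eps0.
  have c1 : {for s0, continuous (fun s : R => p + s *: (x - p))}.
    exact: continuous_line.
  have c2 : (fun q : R * E => p + q.1 *: (q.2 + x - p)) @ (s0, (0 : E)) -->
      p + s0 *: (x - p).
    rewrite -{2}[x]add0r.
    apply: cvgD; first exact: cvg_cst.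
    apply: cvgZ; first exact: cvg_fst.
    apply: cvgB; last exact: cvg_cst.
    by apply: cvgD; [exact: cvg_snd|exact: cvg_cst].
  have [[S V] [/= nS nV] SV] := c2 B nB.
  exists ((fun s => A (p + s *: (x - p))) `&` S, V).
    by split => //; apply: filterI => //; exact: (c1 A nA).
  move=> [s v] [/= [As Ss] Vv].
  have := AB (p + s *: (x - p), p + s *: (v + x - p)).
  have -> : p + s *: (v + x - p) - (p + s *: (x - p)) = s *: v.
    by rewrite opprD addrACA subrr add0r -scalerBr -[v + x - p]addrA addrK.
  by apply; split=> //=; exact: (SV (s, v)).
have nearU : \forall v \near (0 : E), U (v + x).
  have : (fun v : E => v + x) @ (0 : E) --> 0 + x.
    by apply: cvgD; [exact: cvg_id|exact: cvg_cst].
  by rewrite add0r; apply; exact: open_nbhs_nbhs.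
apply: filterS2 tube nearU => v tube Uvx.
have cv : continuous01 (fun s => s ^+ j * G (p + s *: (v + x - p))).
  exact: ray_continuous.
have c1 := @continuous01_cst R (-1).
have cx : continuous01 (fun s => s ^+ j * G (p + s *: (x - p))).
  exact: ray_continuous.
have cL : continuous01 (fun s => s ^+ j.+1 * 'D_v G (p + s *: (x - p))).
  exact: cD.
have -> : ray_average j G (v + x) - ray_average j G x - L v =
  int01 (fun s => -1 * (s ^+ j.+1 * 'D_v G (p + s *: (x - p))) +
    (-1 * (s ^+ j * G (p + s *: (x - p))) + s ^+ j * G (p + s *: (v + x - p)))).
  rewrite int01_linear//; last first.
    by apply: continuous01D => //; apply: continuous01M.
  rewrite int01_linear// !mulN1r [RHS]addrC.
  by congr (_ - _); rewrite [RHS]addrC.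
apply: int01_norm_le => [|s s01].
  apply: continuous01D; first exact: continuous01M.
  by apply: continuous01D => //; apply: continuous01M.
have dGs := dG _ (ray_ball Ux s01).
have -> : -1 * (s ^+ j.+1 * 'D_v G (p + s *: (x - p))) +
    (-1 * (s ^+ j * G (p + s *: (x - p))) + s ^+ j * G (p + s *: (v + x - p)))
  = s ^+ j * (G (p + s *: (v + x - p)) - G (p + s *: (x - p)) -
     'D_(s *: v) G (p + s *: (x - p))).
  have -> : 'D_(s *: v) G (p + s *: (x - p)) = s * 'D_v G (p + s *: (x - p)).
    by rewrite !deriveE// linearZ.
  by rewrite exprS; ring.
have [s0 s1] := andP s01; rewrite normrM.
have sj : `|s ^+ j| <= 1 by rewrite normrX ger0_norm// exprn_ile1.
have := tube s; rewrite /= in_itv /= => /(_ s01) tubes.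
rewrite -[leRHS]mul1r; apply: ler_pM => //.
apply: le_trans tubes _; rewrite ler_pM2l// normrZ ger0_norm//.
by rewrite ler_piMl.
Qed.

Lemma smooth_derive (F : normedModType R) (V : set E) (G : E -> F) v :
  smooth_on V G -> smooth_on V ('D_v G).
Proof. by move=> CG k; have [_] := CG k.+1; exact. Qed.

Lemma ray_average_smooth j (G : E -> R^o) :
  smooth_on U G -> smooth_on U (ray_average j G).
Proof.
move=> CG k; elim: k j G CG => [|k IH] j G CG.
  move=> x Ux; apply: differentiable_continuous.
  by have [] := ray_average_diff j (CG 1%N) Ux.
split=> [x Ux|v]; first by have [] := ray_average_diff j (CG 1%N) Ux.
apply: eq_Ck (IH j.+1 _ (smooth_derive v CG)); first exact: ball_open.
by move=> x Ux; have [_ ->] := ray_average_diff j (CG 1%N) Ux.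
Qed.

(** The fundamental theorem of calculus along the segment from p to x. *)
Lemma hadamard (f : E -> R^o) : smooth_on U f ->
  exists h : @frame_idx _ _ frE -> E -> R^o,
    [/\ forall i, smooth_on U (h i),
        forall i, h i p = 'D_(frame_vec i) f p &
        forall x, U x -> f x = f p + \sum_i frame_co i (x - p) * h i x].
Proof.
move=> sf; exists (fun i => ray_average 0 ('D_(frame_vec i) f)).
have [df cDf] := sf 1%N.
split=> [i|i|x Ux].
- exact/ray_average_smooth/smooth_derive.
- rewrite /ray_average -[RHS]int01_cst; apply: eq_int01 => s _.
  by rewrite mul1r subrr scaler0 addr0.
apply/eqP; rewrite addrC -subr_eq; apply/eqP.
have cD v : continuous01 (fun s => 'D_v f (p + s *: (x - p))).
  have := @ray_continuous 0 ('D_v f) x (cDf v) Ux.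
  by congr continuous01; apply/funext => s; rewrite mul1r.
have dline (s : R) : 0 <= s <= 1 ->
    is_derive s 1 (fun s => f (p + s *: (x - p))) ('D_(x - p) f (p + s *: (x - p))).
  by move=> s01; apply/is_derive_line/df/ray_ball.
have FTC := int01_FTC dline (cD _).
rewrite scale1r scale0r addr0 subrKC in FTC.
rewrite -FTC.
have -> : int01 (fun s => 'D_(x - p) f (p + s *: (x - p))) =
   int01 (fun s => \sum_i frame_co i (x - p) * 'D_(frame_vec i) f (p + s *: (x - p))).
  by apply: eq_int01 => s s01; rewrite derive_frame//; exact/df/ray_ball.
elim: (index_enum _) => [|i r IH].
  rewrite big_nil -[RHS](int01_cst); apply: eq_int01 => s _.
  by rewrite big_nil.
rewrite big_cons -IH.
rewrite [ray_average _ _ _](_ : _ = int01 (fun s => 'D_(frame_vec i) f (p + s *: (x - p)))); last first.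
  by apply: eq_int01 => s _; rewrite mul1r.
rewrite -int01_linear//; last first.
  elim: r {IH} => [|j r IH].
    by under eq_fun do rewrite big_nil; exact: continuous01_cst.
  under eq_fun do rewrite big_cons.
  apply: continuous01D => //; apply: continuous01M => //.
  exact: continuous01_cst.
by apply: eq_int01 => s _; rewrite big_cons.
Qed.

End Hadamard.

(** * Smooth maps and smooth functions on manifolds *)
Section Manifolds.
Context {R : realType}.
Implicit Types E F : normedModType R.

Lemma smooth_funP E (M : manifoldType E) (f : M -> R^o) :
  f \in smooth_fun (M := M) <->
  forall c : chart E M, atlas c -> smooth_on (chart_cod c) (f \o chart_inv c).
Proof. by split=> [/asboolP|?]; last apply/asboolP. Qed.

Lemma Cinf_smooth E (M : manifoldType E) (f : Cinf M) (c : chart E M) :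
  atlas c -> smooth_on (chart_cod c) (f \o chart_inv c).
Proof. by move=> ac; case: f => f /= /smooth_funP; apply. Qed.

Lemma Cinf_ext E (M : manifoldType E) (f g : Cinf M) :
  (forall p, f p = g p) -> f = g.
Proof. by move=> fg; apply/val_inj/funext. Qed.

Lemma open_chart_dom_preimage E (M : topologicalType) (c : chart E M) (A : set E) :
  open A -> open (chart_dom c `&` c @^-1` A).
Proof.
move=> oA; rewrite openE => p [cp Ap]; apply: filterI.
  exact: open_nbhs_nbhs (conj (chart_dom_open c) cp).
by apply: (chart_map_continuous cp); exact: open_nbhs_nbhs.
Qed.

Lemma Cinf_continuous E (M : manifoldType E) (f : Cinf M) : continuous f.
Proof.
move=> p; have [c ac cp] := atlas_cover p.
have cf : {for p, continuous ((f \o chart_inv c) \o c)}.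
  apply: continuous_comp; first exact: chart_map_continuous.
  exact: (Cinf_smooth f ac 0%N) (chart_map_cod cp).
rewrite /prop_for /continuous_at /= chart_mapK// in cf.
apply: cvg_trans cf; apply: near_eq_cvg.
have := open_nbhs_nbhs (conj (chart_dom_open c) cp).
by apply: filterS => q cq /=; rewrite chart_mapK.
Qed.

Lemma smooth_fun_comp E F {frF : frame F} (M : manifoldType E)
    (N : manifoldType F) (u : M -> N) (f : Cinf N) :
  smooth_map u -> f \o u \in smooth_fun (M := M).
Proof.
move=> [cu su]; apply/smooth_funP => c ac k; apply: Ck_local => x cx.
have [d ad dq] := atlas_cover (u (chart_inv c x)).
exists (chart_cod c `&` (u \o chart_inv c) @^-1` chart_dom d) => //.
have oV := open_chart_preimage c cu (chart_dom_open d).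
apply: (eq_Ck oV) (Ck_comp_real oV _ (su c d ac ad k) (Cinf_smooth f ad k)).
  by move=> y [cy dy] /=; rewrite chart_mapK.
by move=> y [cy dy]; apply: chart_map_cod.
Qed.

(** The proof that u is smooth is an argument, so that the pulled back function
    can be fed to a vector field, which acts on bundled smooth functions only. *)
Definition pullback E F {frF : frame F} (M : manifoldType E)
    (N : manifoldType F) (u : M -> N) (su : smooth_map u) (f : Cinf N) : Cinf M :=
  MkCinf (smooth_fun_comp f su).

Lemma smooth_map_id E (M : manifoldType E) : smooth_map (@id M).
Proof.
by split=> [x|c d ac ad]; [exact: cvg_id|exact: atlas_compatible].
Qed.

Lemma smooth_map_cst E F (M : manifoldType E) (N : manifoldType F) (q : N) :
  smooth_map (fun _ : M => q).
Proof.
split=> [x|c d ac ad k]; first exact: cst_continuous.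
exact: (@Ck_cst _ _ _ _ _ (d q)).
Qed.

Lemma smooth_map_comp E F G {frF : frame F} {frG : frame G} (M : manifoldType E)
    (N : manifoldType F) (P : manifoldType G) (u : M -> N) (w : N -> P) :
  smooth_map u -> smooth_map w -> smooth_map (w \o u).
Proof.
move=> [cu su] [cw sw].
have cwu : continuous (w \o u).
  by move=> x; apply: continuous_comp; [exact: cu|exact: cw].
split=> // c d ac ad k; apply: Ck_local => x [cx dx].
have [b ab bq] := atlas_cover (u (chart_inv c x)).
pose V := (chart_cod c `&` (u \o chart_inv c) @^-1` chart_dom b) `&`
  (chart_cod c `&` ((w \o u) \o chart_inv c) @^-1` chart_dom d).
have oV : open V.
  by apply: openI; apply: open_chart_preimage => //; exact: chart_dom_open.
exists V; first by split.
have Cu : Ck k V (b \o u \o chart_inv c).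
  by apply: Ck_sub (su c b ac ab k); exact: subIsetl.
have oW := open_chart_preimage b cw (chart_dom_open d).
apply: (eq_Ck oV) (Ck_comp oV oW _ Cu (sw b d ab ad k)).
  by move=> y [[cy by_] [_ dy]] /=; rewrite chart_mapK.
move=> y [[cy by_] [_ dy]]; split; first exact: chart_map_cod.
by rewrite /= chart_mapK.
Qed.

Lemma smooth_map_pair E F G (M : manifoldType E)
    (N : manifoldType F) (P : manifoldType G) (u : M -> N) (w : M -> P) :
  smooth_map u -> smooth_map w -> smooth_map (fun x => (u x, w x)).
Proof.
move=> [cu su] [cw sw].
have cuw : continuous (fun x => (u x, w x)).
  by move=> x; apply: cvg_pair; [exact: cu|exact: cw].
split=> // c _ ac [d1 [d2 [ad1 ad2 ->]]] k.
set V := (X in Ck _ X _).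
have oV : open V.
  by apply: open_chart_preimage => //; exact: (chart_dom_open (product_chart d1 d2)).
apply: Ck_pair => //.
  by apply: Ck_sub (su c d1 ac ad1 k) => x [? [? ?]].
by apply: Ck_sub (sw c d2 ac ad2 k) => x [? [? ?]].
Qed.

Lemma smooth_map_fst E F (M : manifoldType E) (N : manifoldType F) :
  smooth_map (fst : M * N -> M).
Proof.
have cfst : continuous (fst : M * N -> M) by move=> x; exact: cvg_fst.
split=> // _ d [c1 [c2 [ac1 ac2 ->]]] ad k.
apply: (Ck_linear (L := fst)) (atlas_compatible _ _ ac1 ad k) => //.
  by move=> x; exact: cvg_fst.
by move=> x [[? ?] ?].
Qed.

Lemma smooth_map_snd E F (M : manifoldType E) (N : manifoldType F) :
  smooth_map (snd : M * N -> N).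
Proof.
have csnd : continuous (snd : M * N -> N) by move=> x; exact: cvg_snd.
split=> // _ d [c1 [c2 [ac1 ac2 ->]]] ad k.
apply: (Ck_linear (L := snd)) (atlas_compatible _ _ ac2 ad k) => //.
  by move=> x; exact: cvg_snd.
by move=> x [[? ?] ?].
Qed.

End Manifolds.

Section Extension.
Context {R : realType} {E : normedModType R} {frE : frame E}.
Variables (M : manifoldType E) (c : chart E M) (p : M).
Hypotheses (ac : atlas c) (cp : chart_dom c p).

(** A local function w times a cutoff chi extends smoothly by 0. The support of
    chi corresponds to a compact subset of M, closed because M is a Hausdorff
    space, so that the extension is smooth off the domain of the chart too. One
    chi serves for all w: products of extensions are compared pointwise below. *)
Lemma extension_by_zero : exists (e : R) (chi : E -> R^o),
  [/\ 0 < e, ball (c p) e `<=` chart_cod c, chi (c p) = 1 &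
   smooth_on setT chi /\ forall w : E -> R^o, smooth_on (ball (c p) e) w ->
   exists f : Cinf M, forall q,
     (chart_dom c q -> ball (c p) e (c q) -> f q = chi (c q) * w (c q)) /\
     (~ (chart_dom c q /\ ball (c p) e (c q)) -> f q = 0)].
Proof.
have oc := chart_cod_open c.
have /nbhs_ballP[e /= e0 Be] := open_nbhs_nbhs (conj oc (chart_map_cod cp)).
have [chi [K [schi chip cK KB chi0]]] := cutoff_exists (c p) e0.
exists e, chi; split=> //; split=> // w sw.
set B := ball (c p) e; have oB : open B by exact: ball_open.
pose W := chart_dom c `&` c @^-1` B.
have oW : open W by exact: open_chart_dom_preimage.
pose f q : R^o := if `[< W q >] then chi (c q) * w (c q) else 0.
have fW q : W q -> f q = chi (c q) * w (c q) by move=> Wq; rewrite /f asboolT.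
have fNW q : ~ W q -> f q = 0 by move=> Wq; rewrite /f asboolF.
suff sf : f \in smooth_fun (M := M).
  by exists (MkCinf sf) => q; split=> [? ?|?]; [exact: fW|exact: fNW].
pose K' := chart_inv c @` K.
have clK' : closed K'.
  apply: compact_closed; first exact: (manifold_hausdorff (s := M)).
  apply: continuous_compact => //.
  by apply: continuous_in_subspaceT => x /set_mem/KB/Be cx;
    exact: chart_inv_continuous.
have KW : K' `<=` W.
  move=> _ [x /KB Bx <-]; have cx := Be _ Bx.
  by split; [exact: chart_inv_dom|rewrite /= chart_invK].
apply/smooth_funP => d ad k; apply: Ck_local => y dy.
have cid : continuous (@id M) by move=> x; exact: cvg_id.
have [Wy|Wy] := pselect (W (chart_inv d y)).
  pose V := chart_cod d `&` (id \o chart_inv d) @^-1` W.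
  have oV : open V by exact: open_chart_preimage.
  exists V => //.
  have C1 : Ck k B (chi \* w).
    by apply: (CkM oB _ (sw k)); apply: Ck_sub (schi k) => //.
  have C2 : Ck k V (c \o chart_inv d).
    by apply: Ck_sub (atlas_compatible d c ad ac k) => x [? [? ?]].
  apply: (eq_Ck oV) (Ck_comp_real oV _ C2 C1).
    by move=> x [dx Wx] /=; rewrite fW.
  by move=> x [dx [? ?]].
pose V := chart_cod d `&` (id \o chart_inv d) @^-1` (~` K').
have oV : open V by apply: open_chart_preimage => //; exact: closed_openC.
exists V; first by split=> // /KW.
apply: (eq_Ck oV) (@Ck_cst _ _ R^o k V 0) => x [dx Kx] /=.
have [Wx|/fNW//] := pselect (W (chart_inv d x)).
rewrite fW// chi0 ?mul0r// => Kcx; apply: Kx.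
by exists (c (chart_inv d x)) => //; rewrite chart_mapK//; case: Wx.
Qed.

End Extension.

(** * Derivations at a point *)
Section PointDerivations.
Context {R : realType} {E : normedModType R} {frE : frame E}.
Variables (M : manifoldType E) (c : chart E M) (p : M).
Hypotheses (ac : atlas c) (cp : chart_dom c p).

Lemma CinfDE (f g : Cinf M) q : (f + g) q = f q + g q. Proof. by []. Qed.
Lemma CinfME (f g : Cinf M) q : (f * g) q = f q * g q. Proof. by []. Qed.
Lemma CinfZE (a : R) (f : Cinf M) q : (a *: f) q = a * f q. Proof. by []. Qed.
Lemma Cinf_sumE (I : Type) (r : seq I) (f : I -> Cinf M) q :
  (\sum_(i <- r) f i) q = \sum_(i <- r) f i q.
Proof. by elim/big_rec2: _ => // i x y _ <-. Qed.

(** The coordinate centred at c p, times a cutoff: as the coordinate vanishes at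
    c p and the cutoff is 1 there, the product rule leaves the derivative of the
    coordinate. *)
Lemma coordinate_function (i : @frame_idx _ _ frE) :
  exists f : Cinf M, forall u, 'D_u (f \o chart_inv c) (c p) = frame_co i u.
Proof.
have [e [chi [e0 Be chip [schi ext]]]] := extension_by_zero ac cp.
pose x : E -> R^o := fun y => frame_co i y - frame_co i (c p).
have oB : open (ball (c p) e) by exact: ball_open.
have dx y : differentiable x y.
  apply: differentiableD => //.
  exact/linear_differentiable/frame_linear_continuous.
have sx : smooth_on (ball (c p) e) x.
  move=> k; apply: (CkD oB); first exact: Ck_lin.
  exact: Ck_cst.
have [f fE] := ext _ sx; exists f => u.
have near_f : \forall y \near c p, (chi \* x) y = (f \o chart_inv c) y.
  have := open_nbhs_nbhs (conj oB (ballxx (c p) e0)).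
  apply: filterS => y By; have cy := Be y By.
  by rewrite /= (fE _).1 ?chart_invK//; exact: chart_inv_dom.
rewrite -(near_eq_derive _ near_f).
have dchi : differentiable chi (c p) by have [df _] := schi 1%N; exact: df.
rewrite deriveM; [|exact: diff_derivable..].
rewrite /x subrr scale0r addr0 chip scale1r.
rewrite deriveB; [|apply: diff_derivable..] => //.
  by rewrite derive_cst subr0 derive_linear.
exact/linear_differentiable/frame_linear_continuous.
Qed.

Lemma tangent_uniq (v w : E) :
  (forall f : Cinf M, 'D_v (f \o chart_inv c) (c p) =
                      'D_w (f \o chart_inv c) (c p)) -> v = w.
Proof.
move=> vw; rewrite (frameE v) (frameE w); apply: eq_bigr => i _.
by have [f fE] := coordinate_function i; rewrite -!fE vw.
Qed.

(** With Q the cutoff and X i, H i the extensions of the coordinates and of the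
    coefficients h i of Hadamard's lemma, Q^2 f = f p * Q^2 + \sum_i X i * H i holds
    on all of M. Applying D, the terms with D (Q^2) cancel, and only the products
    D (X i) * H i p remain since X i vanishes at p. *)
Lemma point_derivation (D : Cinf M -> R^o) : linear D ->
  (forall f g, D (f * g) = f p * D g + g p * D f) ->
  exists v, forall f : Cinf M, D f = 'D_v (f \o chart_inv c) (c p).
Proof.
move=> linD leibD.
have [e [chi [e0 Be chip [schi ext]]]] := extension_by_zero ac cp.
pose x (i : @frame_idx _ _ frE) : E -> R^o := fun y => frame_co i (y - c p).
have oB : open (ball (c p) e) by exact: ball_open.
have sx i : smooth_on (ball (c p) e) (x i).
  move=> k; apply: (@eq_Ck _ _ _ k _
      ((frame_co i : E -> R^o) \+ cst (- frame_co i (c p) : R^o))) => //.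
    by move=> y _; rewrite /x linearB.
  by apply: (CkD oB); [exact: Ck_lin|exact: Ck_cst].
have [X XE] := choice (fun i => ext _ (sx i)).
have [Q QE] := ext (cst 1) (fun k => @Ck_cst _ _ R^o k _ 1).
exists (\sum_i D (X i) *: frame_vec i) => f.
have sf : smooth_on (ball (c p) e) (f \o chart_inv c).
  by move=> k; apply: Ck_sub (Cinf_smooth f ac k).
have [h [sh hp hE]] := hadamard e0 sf.
have [H HE] := choice (fun i => ext _ (sh i)).
have Bp := ballxx (c p) e0.
have Qp : Q p = 1 by rewrite (QE p).1// chip mulr1.
have Xp i : X i p = 0 by rewrite (XE i p).1// /x subrr linear0 mulr0.
have Hp i : H i p = 'D_(frame_vec i) (f \o chart_inv c) (c p).
  by rewrite (HE i p).1// chip mul1r hp.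
have fQ : Q * Q * f = f p *: (Q * Q) + \sum_i X i * H i.
  apply: Cinf_ext => q; rewrite CinfDE CinfZE Cinf_sumE !CinfME.
  under eq_bigr do rewrite CinfME.
  have [[cq Bq]|nq] := pselect (chart_dom c q /\ ball (c p) e (c q)).
    have fq := hE _ Bq; rewrite /= !chart_mapK// in fq.
    rewrite (QE q).1// mulr1 fq mulrDr [_ * f p]mulrC; congr (_ + _).
    rewrite mulr_sumr; apply: eq_bigr => i _.
    by rewrite (XE i q).1// (HE i q).1// /x; ring.
  rewrite (QE q).2// !mul0r mulr0 add0r big1// => i _.
  by rewrite (XE i q).2// mul0r.
have DD g g' : D (g + g') = D g + D g' by rewrite -[g]scale1r linD !scale1r.
have D0 : D 0 = 0 by have := DD 0 0; rewrite addr0 => /eqP; rewrite -subr_eq subrr => /eqP.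
have DZ a g : D (a *: g) = a * D g by rewrite -[a *: g]addr0 linD D0 addr0.
have Dsum : D (\sum_i X i * H i) =
    \sum_i D (X i) * 'D_(frame_vec i) (f \o chart_inv c) (c p).
  have -> : D (\sum_i X i * H i) = \sum_i D (X i * H i).
    by elim/big_rec2: _ => // i a b _ <-; rewrite DD.
  by apply: eq_bigr => i _; rewrite leibD Xp Hp mul0r add0r mulrC.
have := congr1 D fQ; rewrite leibD CinfME Qp !mul1r DD DZ Dsum addrC => /addrI ->.
have [df _] := Cinf_smooth f ac 1%N.
have dfp := df _ (chart_map_cod cp).
rewrite deriveE// linear_sum; apply: eq_bigr => i _.
by rewrite linearZ deriveE.
Qed.

End PointDerivations.

(** * The Lie algebra as the tangent space at the unit *)
Section Partial.
Context {R : realType}.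
Implicit Types E F V : normedModType R.

Lemma derive_pairl E F V (f : E * F -> V) x y v :
  'D_v (fun x => f (x, y)) x = 'D_(v, 0) f (x, y).
Proof.
rewrite /derive; set q1 := fun h => _; set q2 := fun h => _.
suff -> : q1 = q2 by [].
apply/funext => h; rewrite /q1 /q2 /=.
suff -> : h *: (v, 0 : F) + (x, y) = (h *: v + x, y) by [].
have -> : h *: (v, 0 : F) = (h *: v, 0) by congr (_, _); rewrite scaler0.
by congr (_, _); rewrite add0r.
Qed.

Lemma derive_pairr E F V (f : E * F -> V) x y v :
  'D_v (fun y => f (x, y)) y = 'D_(0, v) f (x, y).
Proof.
rewrite /derive; set q1 := fun h => _; set q2 := fun h => _.
suff -> : q1 = q2 by [].
apply/funext => h; rewrite /q1 /q2 /=.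
suff -> : h *: (0 : E, v) + (x, y) = (x, h *: v + y) by [].
have -> : h *: (0 : E, v) = (0, h *: v) by congr (_, _); rewrite scaler0.
by congr (_, _); rewrite add0r.
Qed.

(** In a product chart this is a directional derivative of a smooth function,
    restricted to a slice. *)
Lemma partial_smooth E F {frE : frame E} {frF : frame F} (M : manifoldType E)
    (N : manifoldType F) (c : chart F N) q v (f : Cinf (M * N)%type) :
  atlas c -> chart_dom c q ->
  (fun p => 'D_v (fun x => f (p, chart_inv c x)) (c q)) \in smooth_fun (M := M).
Proof.
move=> ac cq; apply/smooth_funP => d ad k.
have ap : atlas (product_chart d c) by exists d, c.
have sf : smooth_on (chart_cod (product_chart d c))
    (f \o chart_inv (product_chart d c)) by apply: Cinf_smooth.
have [_ /(_ (0, v)) Cf] := sf k.+1.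
have od := chart_cod_open d.
have Ci : Ck k (chart_cod d) (fun y => (y, c q)).
  by apply: Ck_pair => //; [exact: Ck_id|exact: (@Ck_cst _ _ _ _ _ (c q))].
apply: (eq_Ck od) (Ck_comp_real od _ Ci Cf).
  by move=> y dy /=; rewrite (derive_pairr (f \o chart_inv (product_chart d c))).
by move=> y dy; split=> //; exact: chart_map_cod.
Qed.

End Partial.

Section LieGroups.
Context {R : realType} {E : normedModType R} {frE : frame E}.
Variable G : lieGroupType E.

Lemma ltrans_smooth (g : G) : smooth_map (fun p : G => (g * p)%g).
Proof.
apply: (smooth_map_comp (u := fun p : G => (g, p)) (w := fun q : G * G => (q.1 * q.2)%g)).
  by apply: smooth_map_pair; [exact: smooth_map_cst|exact: smooth_map_id].
exact: mulg_smooth.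
Qed.

Lemma livfD (X : lieAlg G) f h : X (f + h) = X f + X h.
Proof. by have [l _ _] := lieAlgP X; rewrite -[f]scale1r l !scale1r. Qed.

Lemma livfZ (X : lieAlg G) a f : X (a *: f) = a *: X f.
Proof.
have [l _ _] := lieAlgP X; have X0 : X 0 = 0.
  by have := livfD X 0 0; rewrite addr0 => /eqP;
     rewrite -subr_eq subrr => /eqP.
by rewrite -[a *: f]addr0 l X0 addr0.
Qed.

Lemma lieAlgE (a : R) (X Y : lieAlg G) f : (a *: X + Y) f = a *: X f + Y f.
Proof. by []. Qed.

(** A left-invariant field is determined by its value at the unit. *)
Lemma livf_translate (X : lieAlg G) f p :
  X f p = X (pullback (ltrans_smooth p) f) 1%g.
Proof.
have [_ _ inv] := lieAlgP X.
by rewrite (inv p f (pullback (ltrans_smooth p) f)) ?mulg1.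
Qed.

Lemma lieAlg_eq (X Y : lieAlg G) :
  (forall f, X f 1%g = Y f 1%g) -> X = Y.
Proof.
move=> XY; apply/val_inj/funext => f; apply: Cinf_ext => p.
by rewrite /= [LHS]livf_translate [RHS]livf_translate XY.
Qed.

Section Chart.
Variable c : chart E G.
Hypotheses (ac : atlas c) (c1 : chart_dom c 1%g).

Lemma lieAlg_tangent (X : lieAlg G) :
  exists v, forall f : Cinf G, X f 1%g = 'D_v (f \o chart_inv c) (c 1%g).
Proof.
apply: (point_derivation ac c1 (D := fun f => X f 1%g)) => [a f h|f h].
  by rewrite livfD livfZ.
have [_ leib _] := lieAlgP X.
by rewrite leib CinfDE !CinfME addrC [X f _ * _]mulrC.
Qed.

Lemma left_field_smooth v (f : Cinf G) :
  (fun p => 'D_v (fun x => f (p * chart_inv c x)%g) (c 1%g)) \in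
    smooth_fun (M := G).
Proof. exact: (partial_smooth v (pullback mulg_smooth f) ac c1). Qed.

(** The field with value v at the unit: its value at p is the image of v by the
    left translation by p. *)
Definition left_field v (f : Cinf G) : Cinf G := MkCinf (left_field_smooth v f).

Lemma left_field_invariant v : left_field v \in left_invariant_field (G := G).
Proof.
have df (f : Cinf G) p w : derivable (fun x => f (p * chart_inv c x)%g : R^o) (c 1%g) w.
  apply: diff_derivable.
  have [d _] := Cinf_smooth (pullback (ltrans_smooth p) f) ac 1%N.
  exact: d _ (chart_map_cod c1).
have c1K : chart_inv c (c 1%g) = 1%g by rewrite chart_mapK.
apply/asboolP; split=> [a f h|f h|g f fg fgE p].
- apply: Cinf_ext => p; rewrite CinfDE CinfZE /=.
  rewrite -[a * _]/(a *: _) -deriveZ// -deriveD//; last exact: derivableZ.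
- apply: Cinf_ext => p; rewrite CinfDE !CinfME /=.
  rewrite (_ : (fun x => _) = (fun x => f (p * chart_inv c x)%g : R^o) * (fun x => h (p * chart_inv c x)%g))//.
  rewrite deriveM// c1K mulg1 /GRing.scale /=; ring.
- rewrite /=; congr (derive _ _ _); apply/funext => x.
  by rewrite fgE mulgA.
Qed.

Lemma lieAlg_exists v :
  exists X : lieAlg G, forall f, X f 1%g = 'D_v (f \o chart_inv c) (c 1%g).
Proof.
exists (MkLieAlg (left_field_invariant v)) => f /=.
by congr (derive _ _ _); apply/funext => x; rewrite mul1g.
Qed.

End Chart.

Definition unit_chart : chart E G := sval (cid2 (atlas_cover (1%g : G))).
Lemma unit_chart_atlas : atlas unit_chart.
Proof. by rewrite /unit_chart; case: cid2. Qed.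
Lemma unit_chart1 : chart_dom unit_chart 1%g.
Proof. by rewrite /unit_chart; case: cid2. Qed.

Definition tangent (X : lieAlg G) : E :=
  sval (cid (lieAlg_tangent unit_chart_atlas unit_chart1 X)).

Lemma tangentP (X : lieAlg G) (f : Cinf G) :
  X f 1%g = 'D_(tangent X) (f \o chart_inv unit_chart) (unit_chart 1%g).
Proof. by rewrite /tangent; case: cid. Qed.

Lemma tangent_eq (X : lieAlg G) v :
  (forall f : Cinf G, X f 1%g = 'D_v (f \o chart_inv unit_chart) (unit_chart 1%g)) ->
  tangent X = v.
Proof.
move=> Xv; apply: (tangent_uniq unit_chart_atlas unit_chart1) => f.
by rewrite -tangentP Xv.
Qed.

Lemma unit_chart_differentiable (f : Cinf G) :
  differentiable (f \o chart_inv unit_chart) (unit_chart 1%g).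
Proof.
have [d _] := Cinf_smooth f unit_chart_atlas 1%N.
exact: d _ (chart_map_cod unit_chart1).
Qed.

Lemma tangent_linear : linear tangent.
Proof.
move=> a X Y; apply: tangent_eq => f.
have df := unit_chart_differentiable f.
by rewrite lieAlgE CinfDE CinfZE !tangentP !deriveE// linearP.
Qed.

Lemma tangent_inj : injective tangent.
Proof. by move=> X Y XY; apply: lieAlg_eq => f; rewrite !tangentP XY. Qed.

Lemma tangent_surj v : exists X, tangent X = v.
Proof.
have [X XE] := lieAlg_exists unit_chart_atlas unit_chart1 v.
by exists X; apply: tangent_eq.
Qed.

(** The derivative along the diagonal is the sum of the two partial derivatives,
    because (v, v) = (v, 0) + (0, v). *)
Lemma derivation_diagonal (X : lieAlg G) (F : Cinf (G * G)%type)
    (Fd Fl Fr : Cinf G) :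
  (forall p, Fd p = F (p, p)) -> (forall p, Fl p = F (p, 1%g)) ->
  (forall p, Fr p = F (1%g, p)) ->
  X Fd 1%g = X Fl 1%g + X Fr 1%g.
Proof.
move=> FdE FlE FrE; rewrite !tangentP; set v := tangent X; set c := unit_chart.
have ac : atlas c by exact: unit_chart_atlas.
have c1 : chart_dom c 1%g by exact: unit_chart1.
pose FF := F \o chart_inv (product_chart c c).
have ap : atlas (product_chart c c) by exists c, c.
have dF : differentiable FF (c 1%g, c 1%g).
  have [d _] := Cinf_smooth F ap 1%N; apply: d.
  by split; exact: chart_map_cod.
have -> : Fl \o chart_inv c = fun x => FF (x, c 1%g).
  by apply/funext => x; rewrite /FF /= FlE chart_mapK.
have -> : Fr \o chart_inv c = fun x => FF (c 1%g, x).
  by apply/funext => x; rewrite /FF /= FrE chart_mapK.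
have -> : Fd \o chart_inv c = FF \o (fun x => (x, x)).
  by apply/funext => x; rewrite /= FdE.
have did : differentiable (@id E) (c 1%g).
  by have [d _] := @Ck_id _ _ frE 1 [set: E]; exact: d.
rewrite derive_comp; [|exact: differentiable_pair|exact: dF].
have -> : 'D_v (fun x : E => (x, x)) (c 1%g) = (v, v).
  rewrite deriveE; last exact: differentiable_pair.
  by rewrite diff_pair// -(deriveE _ did) derive_id.
rewrite derive_pairl derive_pairr !(deriveE _ dF) -linearD.
by congr ('d _ _ _); congr (_, _); rewrite ?addr0 ?add0r.
Qed.

End LieGroups.

(** * The Lie algebra of a product *)
Section Products.
Context {R : realType} {E F : normedModType R} {frE : frame E} {frF : frame F}.
Variables (H : lieGroupType E) (A : lieGroupType F).
Local Notation G := (H * A)%type.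

Lemma inl_smooth : smooth_map (fun p : H => (p, 1%g) : G).
Proof.
by apply: smooth_map_pair; [exact: smooth_map_id|exact: smooth_map_cst].
Qed.

Lemma inr_smooth : smooth_map (fun p : A => (1%g, p) : G).
Proof.
by apply: smooth_map_pair; [exact: smooth_map_cst|exact: smooth_map_id].
Qed.

Local Notation fst_smooth := (@smooth_map_fst R E F H A).
Local Notation snd_smooth := (@smooth_map_snd R E F H A).

Definition proj1_field (X : lieAlg G) (f : Cinf H) : Cinf H :=
  pullback inl_smooth (X (pullback fst_smooth f)).

Definition proj2_field (X : lieAlg G) (f : Cinf A) : Cinf A :=
  pullback inr_smooth (X (pullback snd_smooth f)).

Lemma proj1_invariant X : proj1_field X \in left_invariant_field (G := H).
Proof.
have [lX dX iX] := lieAlgP X; apply/asboolP; split=> [a f h|f h|g f fg fgE p].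
- apply: Cinf_ext => p /=.
  by rewrite (_ : pullback _ _ = a *: pullback fst_smooth f + pullback fst_smooth h)
    ?lX//; exact: Cinf_ext.
- apply: Cinf_ext => p /=.
  by rewrite (_ : pullback _ _ = pullback fst_smooth f * pullback fst_smooth h)
    ?dX//; exact: Cinf_ext.
- rewrite /= (iX (g, 1%g) (pullback fst_smooth f)) /=; last by move=> q /=.
  by congr (X _ (_, _)); rewrite mulg1.
Qed.

Lemma proj2_invariant X : proj2_field X \in left_invariant_field (G := A).
Proof.
have [lX dX iX] := lieAlgP X; apply/asboolP; split=> [a f h|f h|g f fg fgE p].
- apply: Cinf_ext => p /=.
  by rewrite (_ : pullback _ _ = a *: pullback snd_smooth f + pullback snd_smooth h)
    ?lX//; exact: Cinf_ext.
- apply: Cinf_ext => p /=.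
  by rewrite (_ : pullback _ _ = pullback snd_smooth f * pullback snd_smooth h)
    ?dX//; exact: Cinf_ext.
- rewrite /= (iX (1%g, g) (pullback snd_smooth f)) /=; last by move=> q /=.
  by congr (X _ (_, _)); rewrite mulg1.
Qed.

Definition proj1_lie (X : lieAlg G) : lieAlg H := MkLieAlg (proj1_invariant X).
Definition proj2_lie (X : lieAlg G) : lieAlg A := MkLieAlg (proj2_invariant X).

(** A function of the first variable is invariant under the translations by
    (1, q), hence so is its image by X: that image is again a function of the first
    variable. This is what makes the projections commute with brackets. *)
Lemma proj1_lie_related (X : lieAlg G) (f : Cinf H) :
  X (pullback fst_smooth f) = pullback fst_smooth (proj1_lie X f).
Proof.
have [_ _ iX] := lieAlgP X; apply: Cinf_ext => -[p q] /=.
have := iX (1%g, q) (pullback fst_smooth f) (pullback fst_smooth f) _ (p, 1%g).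
move=> ->; last by move=> x /=; rewrite mul1g.
by congr (X _ (_, _)); rewrite ?mulg1 ?mul1g.
Qed.

Lemma proj2_lie_related (X : lieAlg G) (f : Cinf A) :
  X (pullback snd_smooth f) = pullback snd_smooth (proj2_lie X f).
Proof.
have [_ _ iX] := lieAlgP X; apply: Cinf_ext => -[p q] /=.
have := iX (p, 1%g) (pullback snd_smooth f) (pullback snd_smooth f) _ (1%g, q).
move=> ->; last by move=> x /=; rewrite mul1g.
by congr (X _ (_, _)); rewrite ?mulg1 ?mul1g.
Qed.

Lemma proj1_linear : linear proj1_lie.
Proof. by move=> a X Y; apply: lieAlg_eq. Qed.

Lemma proj2_linear : linear proj2_lie.
Proof. by move=> a X Y; apply: lieAlg_eq. Qed.

Lemma proj1_bracket X Y :
  proj1_lie (lie_bracket X Y) = lie_bracket (proj1_lie X) (proj1_lie Y).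
Proof.
apply: lieAlg_eq => f.
by rewrite /= !proj1_lie_related.
Qed.

Lemma proj2_bracket X Y :
  proj2_lie (lie_bracket X Y) = lie_bracket (proj2_lie X) (proj2_lie Y).
Proof.
apply: lieAlg_eq => f.
by rewrite /= !proj2_lie_related.
Qed.

Local Notation pchart := (product_chart (unit_chart H) (unit_chart A)).

Lemma pchart_atlas : atlas (pchart : chart _ G).
Proof.
by exists (unit_chart H), (unit_chart A); split=> //; exact: unit_chart_atlas.
Qed.

Lemma pchart1 : chart_dom pchart 1%g.
Proof. by split; exact: unit_chart1. Qed.

Lemma tangent_proj (X : lieAlg G) v w :
  (forall f : Cinf G, X f 1%g = 'D_(v, w) (f \o chart_inv pchart) (pchart 1%g)) ->
  tangent (proj1_lie X) = v /\ tangent (proj2_lie X) = w.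
Proof.
move=> Xv; split; apply: tangent_eq => f.
  rewrite /= [LHS]Xv; set c := unit_chart H; set d := unit_chart A.
  rewrite (_ : _ \o _ = (f \o chart_inv c) \o fst); last exact/funext.
  rewrite derive_comp; last exact: unit_chart_differentiable.
    by rewrite derive_linear.
  apply: linear_differentiable; exact: frame_linear_continuous.
rewrite /= [LHS]Xv; set c := unit_chart H; set d := unit_chart A.
rewrite (_ : _ \o _ = (f \o chart_inv d) \o snd); last exact/funext.
rewrite derive_comp; last exact: unit_chart_differentiable.
  by rewrite derive_linear.
apply: linear_differentiable; exact: frame_linear_continuous.
Qed.

Lemma proj_inj (X Y : lieAlg G) :
  proj1_lie X = proj1_lie Y -> proj2_lie X = proj2_lie Y -> X = Y.
Proof.
move=> XY1 XY2.
have [[v w] Xv] := lieAlg_tangent pchart_atlas pchart1 X.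
have [[v' w'] Yv] := lieAlg_tangent pchart_atlas pchart1 Y.
have [v1 w1] := tangent_proj Xv; have [v2 w2] := tangent_proj Yv.
apply: lieAlg_eq => f.
by rewrite Xv Yv -v1 -w1 XY1 XY2 v2 w2.
Qed.

Lemma proj_surj (X1 : lieAlg H) (X2 : lieAlg A) :
  exists X, proj1_lie X = X1 /\ proj2_lie X = X2.
Proof.
have [X XE] := lieAlg_exists pchart_atlas pchart1 (tangent X1, tangent X2).
have [v w] := tangent_proj XE.
by exists X; split; apply: tangent_inj.
Qed.

(** A function of the second variable alone is the pullback of a function on
    A, so the fields tangent to H are those with trivial projection to A. *)
Lemma lie_factor1P X : lie_factor1 H A X <-> proj2_lie X = 0.
Proof.
split=> [X0|X0 f fE].
  apply: lieAlg_eq => f /=; rewrite X0//.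
  by move=> p q /= ->.
have -> : f = pullback snd_smooth (pullback inr_smooth f).
  by apply: Cinf_ext => p /=; exact: fE.
rewrite proj2_lie_related X0.
exact: Cinf_ext.
Qed.

Lemma lie_factor2P X : lie_factor2 H A X <-> proj1_lie X = 0.
Proof.
split=> [X0|X0 f fE].
  apply: lieAlg_eq => f /=; rewrite X0//.
  by move=> p q /= ->.
have -> : f = pullback fst_smooth (pullback inl_smooth f).
  by apply: Cinf_ext => p /=; exact: fE.
rewrite proj1_lie_related X0.
exact: Cinf_ext.
Qed.

End Products.

(** * Inversion and commutative groups *)
Section Inversion.
Context {R : realType} {E : normedModType R} {frE : frame E}.
Variable G : lieGroupType E.

Lemma livf_one (X : lieAlg G) : X 1 = 0.
Proof.
have [_ leib _] := lieAlgP X; have := leib 1 1.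
by rewrite !mulr1 mul1r => /eqP; rewrite -subr_eq subrr => /eqP <-.
Qed.

Lemma livf_cst (X : lieAlg G) (f : Cinf G) a : (forall p, f p = a) -> X f = 0.
Proof.
move=> fa; have -> : f = a *: (1 : Cinf G) by apply: Cinf_ext => p; rewrite fa CinfZE mulr1.
by rewrite livfZ livf_one scaler0.
Qed.

Lemma livfN (X : lieAlg G) f : X (- f) = - X f.
Proof. by rewrite -scaleN1r livfZ scaleN1r. Qed.

(** The derivative of the constant function p |-> f (p * p^-1) is, by
    [derivation_diagonal], the sum of X f and of the derivative of f along
    inversion. *)
Lemma livf_inverse (X : lieAlg G) f : X (pullback invg_smooth f) 1%g = - X f 1%g.
Proof.
have s2 : smooth_map (fun q : G * G => (q.1 * q.2^-1)%g).
  apply: (smooth_map_comp (u := fun q : G * G => (q.1, q.2^-1)%g)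
    (w := fun q : G * G => (q.1 * q.2)%g)); last exact: mulg_smooth.
  apply: smooth_map_pair; first exact: smooth_map_fst.
  apply: (smooth_map_comp (u := snd) (w := fun q : G => q^-1%g)).
    exact: smooth_map_snd.
  exact: invg_smooth.
pose Fd : Cinf G := f 1%g *: (1 : Cinf G).
have FdE p : Fd p = f 1%g by rewrite CinfZE mulr1.
have H := derivation_diagonal X (F := pullback s2 f) (Fd := Fd) (Fl := f)
  (Fr := pullback invg_smooth f).
have {}H : X Fd 1%g = X f 1%g + X (pullback invg_smooth f) 1%g.
  apply: H => p; first by rewrite FdE /= mulgV.
    by rewrite /= invg1 mulg1.
  by rewrite /= mul1g.
rewrite (livf_cst X FdE) in H.
by apply/eqP; rewrite -addr_eq0 addrC -H.
Qed.

(** When G is commutative [livf_inverse] holds at every point, so inversion maps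
    each field to its opposite. Applied to X, Y and their bracket, this gives
    [X, Y] = [- X, - Y] = - [X, Y]. *)
Lemma lie_bracket_abelian (X Y : lieAlg G) :
  (forall x y : G, (x * y)%g = (y * x)%g) -> lie_bracket X Y = 0.
Proof.
move=> com.
have inv_rel (Z : lieAlg G) f :
    Z (pullback invg_smooth f) = - pullback invg_smooth (Z f).
  apply: Cinf_ext => p; rewrite livf_translate.
  transitivity (- Z f p^-1%g); last by [].
  rewrite [in RHS]livf_translate -livf_inverse; congr (Z _ 1%g).
  by apply: Cinf_ext => q /=; rewrite invgM com.
apply: lieAlg_eq => f.
have H1 := livf_inverse (lie_bracket X Y) f.
have H2 : lie_bracket X Y (pullback invg_smooth f) 1%g = lie_bracket X Y f 1%g.
  rewrite /= !inv_rel !livfN !inv_rel !opprK.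
  by rewrite -[LHS]/(X (Y f) 1^-1%g - Y (X f) 1^-1%g) invg1.
rewrite H2 in H1; move/eqP: H1; rewrite -addr_eq0 -mulr2n mulrn_eq0 /=.
by move/eqP.
Qed.

End Inversion.

(** * The adjoint action *)
Section Adjoint.
Context {R : realType} {E : normedModType R} {frE : frame E}.
Variable G : lieGroupType E.

Lemma rtrans_smooth (g : G) : smooth_map (fun p : G => (p * g)%g).
Proof.
apply: (smooth_map_comp (u := fun p : G => (p, g)) (w := fun q : G * G => (q.1 * q.2)%g)).
  by apply: smooth_map_pair; [exact: smooth_map_id|exact: smooth_map_cst].
exact: mulg_smooth.
Qed.

(** Conjugation by right translations; this is Ad (g^-1), a right action. *)
Definition adj_field g (X : lieAlg G) (f : Cinf G) : Cinf G :=
  pullback (rtrans_smooth g^-1%g) (X (pullback (rtrans_smooth g) f)).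

Lemma adj_invariant g X : adj_field g X \in left_invariant_field (G := G).
Proof.
have [lX dX iX] := lieAlgP X; apply/asboolP; split=> [a f h|f h|k f fg fgE p].
- apply: Cinf_ext => p /=.
  rewrite (_ : pullback _ _ = a *: pullback (rtrans_smooth g) f
    + pullback (rtrans_smooth g) h); last exact: Cinf_ext.
  by rewrite lX.
- apply: Cinf_ext => p /=.
  rewrite (_ : pullback _ _ = pullback (rtrans_smooth g) f
    * pullback (rtrans_smooth g) h); last exact: Cinf_ext.
  by rewrite dX CinfDE !CinfME /= -mulgA mulVg mulg1.
- rewrite /= (iX k (pullback (rtrans_smooth g) f)) ?mulgA// => q /=.
  by rewrite fgE mulgA.
Qed.

Definition adj g X : lieAlg G := MkLieAlg (adj_invariant g X).

Lemma adj_linear g : linear (adj g).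
Proof. by move=> a X Y; apply: lieAlg_eq. Qed.

Lemma adj_id X : adj 1%g X = X.
Proof.
apply: lieAlg_eq => f /=; rewrite mul1g invg1; congr (X _ _).
by apply: Cinf_ext => p /=; rewrite mulg1.
Qed.

Lemma adj_mul g h X : adj g (adj h X) = adj (h * g)%g X.
Proof.
apply: lieAlg_eq => f /=; rewrite !mul1g invgM; congr (X _ _).
by apply: Cinf_ext => p /=; rewrite mulgA.
Qed.

(** A field tangent to the first factor differentiates in the first variable only:
    its tangent vector at the unit is (v, 0). *)
Lemma livf_left_factor (X1 : lieAlg (G * G)%type) (F : Cinf (G * G)%type) x y
    (Fy : Cinf G) :
  proj2_lie X1 = 0 -> (forall p, Fy p = F (p, y)) -> X1 F (x, y) = proj1_lie X1 Fy x.
Proof.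
move=> X0 FyE; rewrite livf_translate [RHS]livf_translate.
set K := pullback _ F; set K1 := pullback _ Fy.
have [[v w] Xv] := lieAlg_tangent (pchart_atlas G G) (pchart1 G G) X1.
have [v1 w1] := tangent_proj Xv.
have w0 : w = 0.
  by rewrite -w1 X0; apply: tangent_eq => f; rewrite derive0.
rewrite Xv w0 -derive_pairl tangentP v1; congr (derive _ _ _).
apply/funext => z /=; rewrite chart_mapK; last exact: unit_chart1.
rewrite /K1 /= FyE; congr (F _); congr (_, _); exact: mulg1.
Qed.

Lemma livf_right_factor (X2 : lieAlg (G * G)%type) (F : Cinf (G * G)%type) x y
    (Fx : Cinf G) :
  proj1_lie X2 = 0 -> (forall p, Fx p = F (x, p)) -> X2 F (x, y) = proj2_lie X2 Fx y.
Proof.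
move=> X0 FxE; rewrite livf_translate [RHS]livf_translate.
set K := pullback _ F; set K1 := pullback _ Fx.
have [[v w] Xv] := lieAlg_tangent (pchart_atlas G G) (pchart1 G G) X2.
have [v1 w1] := tangent_proj Xv.
have v0 : v = 0.
  by rewrite -v1 X0; apply: tangent_eq => f; rewrite derive0.
rewrite Xv v0 -derive_pairr tangentP w1; congr (derive _ _ _).
apply/funext => z /=; rewrite chart_mapK; last exact: unit_chart1.
rewrite /K1 /= FxE; congr (F _); congr (_, _); exact: mulg1.
Qed.

(** The function h is the restriction of (a, b) |-> X (f (_ * b)) (a^-1) to the
    diagonal, so its derivative is the sum of two partial derivatives. The one in a
    is - Z (X f) by [livf_inverse]. The one in b is Z (b |-> X (f (_ * b)) 1) 1, and
    it has to be compared with X (Z f). With F (x, y) = f (x * y) on G x G, both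
    are mixed derivatives of F by a field X1 of the first factor and a field Z2 of
    the second one; they agree since [X1, Z2] projects to 0 on both factors. Thus
    the symmetry of second derivatives comes from the description of the Lie
    algebra of a product. *)
Lemma adj_smooth (X : lieAlg G) (f : Cinf G) :
  exists h : Cinf G, (forall g, h g = adj g X f 1%g) /\
    forall Z : lieAlg G, Z h 1%g = lie_bracket X Z f 1%g.
Proof.
have [F FE] : exists F : Cinf (G * G)%type, forall q, F q = f (q.1 * q.2)%g.
  by exists (pullback mulg_smooth f).
have [X1 [X1E X10]] := proj_surj X (0 : lieAlg G).
have X1F x g : X1 F (x, g) = X (pullback (rtrans_smooth g) f) x.
  have H p : pullback (rtrans_smooth g) f p = F (p, g) by rewrite FE.
  by rewrite (livf_left_factor _ X10 H) X1E.
have s2 : smooth_map (fun q : G * G => (q.1^-1, q.2)%g).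
  apply: smooth_map_pair; last exact: smooth_map_snd.
  apply: (smooth_map_comp (u := fst) (w := fun q : G => q^-1%g)).
    exact: smooth_map_fst.
  exact: invg_smooth.
have sd : smooth_map (fun q : G => (q, q)).
  by apply: smooth_map_pair; exact: smooth_map_id.
have [FF FFE] : exists FF : Cinf (G * G)%type,
    forall q, FF q = X1 F (q.1^-1%g, q.2).
  by exists (pullback s2 (X1 F)).
exists (pullback sd FF); split=> [g|Z].
  by rewrite /= FFE X1F mul1g.
have [Z2 [Z20 Z2E]] := proj_surj (0 : lieAlg G) Z.
have comm : lie_bracket X1 Z2 = 0.
  apply: proj_inj.
    by rewrite proj1_bracket X1E Z20; apply: lieAlg_eq => h /=;
       rewrite (livf_cst X (a := 0)) ?subrr.
  by rewrite proj2_bracket X10 Z2E; apply: lieAlg_eq => h /=;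
     rewrite (livf_cst Z (a := 0)) ?subrr.
have sr : smooth_map (fun q : G => (1%g, q) : G * G).
  exact: inr_smooth.
rewrite (derivation_diagonal Z (F := FF) (Fl := pullback invg_smooth (X f))
  (Fr := pullback sr (X1 F)))//; first last.
- by move=> p; rewrite FFE /= invg1.
- move=> p; rewrite FFE /= X1F; congr (X _ _).
  by apply: Cinf_ext => q /=; rewrite mulg1.
rewrite livf_inverse addrC; congr (_ - _).
have Fr p : pullback sr (X1 F) p = X1 F (1%g, p) by [].
rewrite -Z2E -(livf_right_factor _ Z20 Fr).
have : lie_bracket X1 Z2 F (1%g, 1%g) = 0 by rewrite comm.
move=> /eqP; rewrite /= subr_eq0 => /eqP <-.
have Zf p : Z f p = Z2 F (p, 1%g).
  have H q : pullback (ltrans_smooth p) f q = F (p, q) by rewrite FE.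
  by rewrite (livf_right_factor _ Z20 H) Z2E -livf_translate.
by rewrite (livf_left_factor _ X10 Zf) X1E -Z2E.
Qed.

End Adjoint.

(** * Bounded matrix groups preserve an inner product *)
Section ContinuousReal.
Context {R : realType} {T : topologicalType}.

Lemma closed_le_fun (f g : T -> R) :
  continuous f -> continuous g -> closed [set u | f u <= g u].
Proof.
move=> cf cg; have -> : [set u | f u <= g u] = (g \- f) @^-1` [set x | 0 <= x].
  by apply/seteqP; split=> u /=; rewrite subr_ge0.
apply: preimage_closed; last exact: closed_ge.
by move=> u _; apply: continuousB; [exact: cg|exact: cf].
Qed.

Lemma continuous_sum_sqr (I : finType) (f : I -> T -> R) :
  (forall i, continuous (f i)) -> continuous (fun u => \sum_i f i u ^+ 2).
Proof.
move=> cf; apply: continuous_big => [|i _ u]; first exact: add_continuous.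
by apply: (@cvgM _ _ _ _ (f i) (f i)); exact: cf.
Qed.

End ContinuousReal.

Section FrobeniusNorm.
Context {R : realType}.

(** The square of the Frobenius norm; only its square occurs, which keeps it
    polynomial in the entries. *)
Definition frob {m n} (A : 'M[R]_(m, n)) : R := \sum_i \sum_j A i j ^+ 2.

Lemma frob_ge0 m n (A : 'M[R]_(m, n)) : 0 <= frob A.
Proof. by apply: sumr_ge0 => i _; apply: sumr_ge0 => j _; exact: sqr_ge0. Qed.

Lemma frob_entry m n (A : 'M[R]_(m, n)) i j : A i j ^+ 2 <= frob A.
Proof.
rewrite /frob (bigD1 i)//= (bigD1 j)//= -addrA lerDl addr_ge0//.
  by apply: sumr_ge0 => k _; exact: sqr_ge0.
by apply: sumr_ge0 => k _; apply: sumr_ge0 => l _; exact: sqr_ge0.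
Qed.

Lemma frob_eq0 m n (A : 'M[R]_(m, n)) : frob A <= 0 -> A = 0.
Proof.
move=> A0; apply/matrixP => i j; rewrite mxE; apply/eqP.
by rewrite -sqrf_eq0 eq_le sqr_ge0 andbT (le_trans (frob_entry A i j)).
Qed.

Lemma frob_tr m n (A : 'M[R]_(m, n)) : frob A^T = frob A.
Proof.
by rewrite /frob exchange_big; apply: eq_bigr => i _; apply: eq_bigr => j _;
  rewrite mxE.
Qed.

(** Lagrange's identity. *)
Lemma sum_cauchy_schwarz (I : finType) (a b : I -> R) :
  (\sum_i a i * b i) ^+ 2 <= (\sum_i a i ^+ 2) * (\sum_i b i ^+ 2).
Proof.
have S : \sum_i \sum_j (a i * b j - a j * b i) ^+ 2 =
    2 * ((\sum_i a i ^+ 2) * (\sum_i b i ^+ 2) - (\sum_i a i * b i) ^+ 2).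
  transitivity (\sum_i \sum_j (a i ^+ 2 * b j ^+ 2 + b i ^+ 2 * a j ^+ 2
      + - 2 * (a i * b i) * (a j * b j))).
    by apply: eq_bigr => i _; apply: eq_bigr => j _; ring.
  under eq_bigr do rewrite !big_split /= -!mulr_sumr.
  rewrite !big_split /= -!mulr_suml -mulr_sumr; ring.
have : 0 <= \sum_i \sum_j (a i * b j - a j * b i) ^+ 2.
  by apply: sumr_ge0 => i _; apply: sumr_ge0 => j _; exact: sqr_ge0.
by rewrite S pmulr_rge0// subr_ge0.
Qed.

Lemma frob_mul m n p (A : 'M[R]_(m, n)) (B : 'M[R]_(n, p)) :
  frob (A *m B) <= frob A * frob B.
Proof.
rewrite /frob mulr_suml; apply: ler_sum => i _.
rewrite [X in _ * X]exchange_big mulr_sumr; apply: ler_sum => j _.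
by rewrite mxE; exact: sum_cauchy_schwarz.
Qed.

Lemma frob_row n (x : 'rV[R]_n) : (x *m x^T) 0 0 = frob x.
Proof.
by rewrite mxE /frob big_ord1; apply: eq_bigr => j _; rewrite mxE expr2.
Qed.

Lemma frob_midpoint m n (A B : 'M[R]_(m, n)) :
  frob (2^-1 *: (A + B)) = 2^-1 * (frob A + frob B) - 4^-1 * frob (A - B).
Proof.
rewrite /frob -big_split mulr_sumr mulr_sumr -sumrB; apply: eq_bigr => i _ /=.
rewrite -big_split mulr_sumr mulr_sumr -sumrB; apply: eq_bigr => j _ /=.
by rewrite !mxE; field.
Qed.

End FrobeniusNorm.

Section InvariantForm.
Context {R : realType} {n : nat}.
Variable S : set 'M[R]_n.
Hypothesis S1 : S 1%:M.
Hypothesis SM : forall M N, S M -> S N -> S (M *m N).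
Hypothesis SV : forall M, S M -> exists2 N, S N & M *m N = 1%:M.
Variable B : R.
Hypothesis SB : forall M, S M -> forall i j, `|M i j| <= B.

Let act (M q : 'M[R]_n) := M *m q *m M^T.

Let actM M N q : act M (act N q) = act (M *m N) q.
Proof. by rewrite /act trmx_mul !mulmxA. Qed.

(** The lower bound by frob x keeps the forms away from degenerate ones: it makes
    every limit of admissible forms positive definite. *)
Definition admissible (r : R) (q : 'M[R]_n) : Prop :=
  [/\ q^T = q, forall M (x : 'rV[R]_n), S M -> frob x <= (x *m act M q *m x^T) 0 0 &
      forall M, S M -> frob (act M q) <= r].

Let K : R := 1 + \sum_(i < n) \sum_(j < n) B ^+ 2.

Let K1 : 1 <= K.
Proof.
by rewrite lerDl; apply: sumr_ge0 => i _; apply: sumr_ge0 => j _; exact: sqr_ge0.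
Qed.

Let K0 : 0 < K. Proof. exact: lt_le_trans ltr01 K1. Qed.

Let frobS M : S M -> frob M <= K.
Proof.
move=> SMM; rewrite /K ler_wpDl//; apply: ler_sum => i _; apply: ler_sum => j _.
by rewrite -real_normK ?num_real// lerXn2r ?nnegrE ?(le_trans _ (SB SMM i j))//;
  exact: SB.
Qed.

Let frob_act M q : S M -> frob (act M q) <= K ^+ 2 * frob q.
Proof.
move=> SMM; apply: le_trans (frob_mul _ _) _; rewrite frob_tr.
apply: le_trans (ler_wpM2r (frob_ge0 _) (frob_mul _ _)) _.
rewrite mulrAC expr2 ler_wpM2r ?frob_ge0//.
by apply: ler_pM; rewrite ?frob_ge0//; exact: frobS.
Qed.

Let frob_act_inv M q : S M -> frob q <= K ^+ 2 * frob (act M q).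
Proof.
move=> SMM; have [N SN MN] := SV SMM.
have {1}-> : q = act N (act M q).
  by rewrite actM (mulmx1C MN) /act mul1mx trmx1 mulmx1.
exact: frob_act.
Qed.

Lemma admissible_ex : exists r q, admissible r q.
Proof.
exists (K ^+ 2 * frob (K%:M : 'M[R]_n)), K%:M; split.
- by rewrite tr_scalar_mx.
- move=> M x SMM; have [N SN MN] := SV SMM.
  have -> : x *m act M K%:M *m x^T = K *: ((x *m M) *m (x *m M)^T).
    by rewrite /act mul_mx_scalar trmx_mul -!scalemxAl -!scalemxAr !mulmxA
       -?scalemxAl.
  rewrite mxE frob_row.
  have {1}-> : x = x *m M *m N by rewrite -mulmxA MN mulmx1.
  apply: le_trans (frob_mul _ _) _; rewrite mulrC ler_wpM2r ?frob_ge0//.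
  exact: frobS.
- by move=> M SMM; exact: frob_act.
Qed.

Lemma admissible_ge0 r q : admissible r q -> 0 <= r.
Proof. by move=> [_ _ /(_ _ S1)]; exact/le_trans/frob_ge0. Qed.

(** The parallelogram identity in each point of the orbit. The gain does not depend
    on M, because acting by M shrinks q - q' at most by a factor K^2. *)
Lemma admissible_midpoint r q q' : admissible r q -> admissible r q' ->
  admissible (r - frob (q - q') / (4 * K ^+ 2)) (2^-1 *: (q + q')).
Proof.
move=> [qT qS qr] [q'T q'S q'r].
have actD M : act M (2^-1 *: (q + q')) = 2^-1 *: (act M q + act M q').
  by rewrite /act -scalemxAr -scalemxAl mulmxDr mulmxDl.
split.
- by rewrite linearZ linearD /= qT q'T.
- move=> M x SMM; rewrite actD -scalemxAr -scalemxAl mulmxDr mulmxDl mxE mxE.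
  have := lerD (qS M x SMM) (q'S M x SMM); lra.
- move=> M SMM; rewrite actD frob_midpoint.
  have -> : act M q - act M q' = act M (q - q').
    by rewrite /act mulmxBr mulmxBl.
  have := lerD (qr M SMM) (q'r M SMM) => H1.
  have H2 := frob_act_inv (q - q') SMM.
  have H3 : frob (q - q') / (4 * K ^+ 2) <= 4^-1 * frob (act M (q - q')).
    rewrite ler_pdivrMr ?mulr_gt0 ?exprn_gt0//.
    by apply: le_trans H2 _; rewrite le_eqVlt; apply/orP; left; apply/eqP; field.
  lra.
Qed.

Let levels : set R := [set r | exists q, admissible r q].

Let levels_inf : has_inf levels.
Proof.
split; first by have [r [q rq]] := admissible_ex; exists r, q.
by exists 0 => r [q] /admissible_ge0.
Qed.

Let a := inf levels.

Let admissible_close r q q' : admissible r q -> admissible r q' ->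
  frob (q - q') <= (4 * K ^+ 2) * (r - a).
Proof.
move=> rq rq'; have := admissible_midpoint rq rq'; set d := _ / _ => rm.
have : a <= r - d by apply: (ge_inf levels_inf.2); exists (2^-1 *: (q + q')).
rewrite lerBrDr -lerBrDl; rewrite /d ler_pdivrMr ?mulr_gt0 ?exprn_gt0//.
by rewrite mulrC.
Qed.

Lemma admissible_le r r' q : r <= r' -> admissible r q -> admissible r' q.
Proof.
move=> rr' [? ? qr]; split=> // M SMM; exact: le_trans (qr M SMM) rr'.
Qed.

Lemma admissible_act r q M : S M -> admissible r q -> admissible r (act M q).
Proof.
move=> SMM [qT qS qr]; split.
- by rewrite /act !trmx_mul trmxK qT mulmxA.
- by move=> N x SN; rewrite actM; apply: qS; exact: SM.
- by move=> N SN; rewrite actM; apply: qr; exact: SM.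
Qed.

Let vec_admissible r := [set u : 'rV[R]_(n * n) | admissible r (vec_mx u)].

Let linear_cont (f : 'rV[R]_(n * n) -> R) :
  linear (f : _ -> R^o) -> continuous f.
Proof.
move=> linf.
pose L : {linear 'rV[R]_(n * n) -> R^o} := HB.pack (f : _ -> R^o)
  (GRing.isLinear.Build _ _ _ _ _ linf).
exact: (frame_linear_continuous (L := L)).
Qed.

Let act_linear M : linear (fun u : 'rV[R]_(n * n) => act M (vec_mx u)).
Proof.
by move=> b u v; rewrite /act linearP mulmxDr mulmxDl -scalemxAr -scalemxAl.
Qed.

Let entry_cont M i j : continuous (fun u => act M (vec_mx u) i j).
Proof. by apply: linear_cont => b u v; rewrite act_linear !mxE. Qed.

Let closed_admissible r : closed (vec_admissible r).
Proof.
have -> : vec_admissible r = [set u | (vec_mx u)^T = vec_mx u] `&`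
  (\bigcap_(M in S) \bigcap_(x in [set: 'rV[R]_n])
     [set u | frob x <= (x *m act M (vec_mx u) *m x^T) 0 0]) `&`
  (\bigcap_(M in S) [set u | frob (act M (vec_mx u)) <= r]).
  apply/seteqP; split=> [u [? h1 h2]|u [[? h1] h2]].
    by split; [split=> // M SMM x _; exact: h1|move=> M SMM; exact: h2].
  by split; [|move=> M x SMM; exact: h1|move=> M SMM; exact: h2].
apply: closedI; first apply: closedI.
- have -> : [set u : 'rV[R]_(n * n) | (vec_mx u)^T = vec_mx u] =
    \bigcap_i \bigcap_j [set u | act 1%:M (vec_mx u) j i <= act 1%:M (vec_mx u) i j].
    apply/seteqP; split=> u /=.
      by move=> uT i _ j _ /=; rewrite /act !mul1mx trmx1 !mulmx1 -[in leLHS]uT mxE.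
    move=> h; apply/matrixP => i j; rewrite mxE; apply/eqP.
    have := h i I j I; have := h j I i I.
    by rewrite /= /act !mul1mx trmx1 !mulmx1 eq_le => -> ->.
  by apply: closed_bigI => i _; apply: closed_bigI => j _; apply: closed_le_fun.
- apply: closed_bigI => M _; apply: closed_bigI => x _; apply: closed_le_fun.
    by move=> u; exact: cst_continuous.
  apply: linear_cont => b u v.
  by rewrite act_linear mulmxDr mulmxDl -scalemxAr -scalemxAl !mxE.
- apply: closed_bigI => M _; apply: closed_le_fun; last first.
    by move=> u; exact: cst_continuous.
  have := @continuous_sum_sqr _ _ ('I_n * 'I_n)%type
    (fun k u => act M (vec_mx u) k.1 k.2) (fun k => entry_cont (i := k.1) (j := k.2)).
  rewrite (_ : (fun u => _) = (fun u => frob (act M (vec_mx u))))//.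
  by apply/funext => u; rewrite /frob pair_big.
Qed.

Let compact_admissible r : compact (vec_admissible r).
Proof.
apply: (@subclosed_compact _ _ [set u : 'rV[R]_(n * n) |
    forall k, `[- (1 + r), 1 + r]%classic (u ord0 k)]).
- exact: closed_admissible.
- by apply: (@rV_compact _ _ (fun=> `[- (1 + r), 1 + r]%classic)) => k;
    exact: segment_compact.
move=> u au k; rewrite /= in_itv /= -ler_norml.
have r0 := admissible_ge0 au.
have {au} [_ _ /(_ _ S1)] := au; rewrite /act mul1mx trmx1 mulmx1 => ur.
rewrite -ler_sqr ?nnegrE ?addr_ge0// real_normK ?num_real//.
have uk : u ord0 k ^+ 2 <= r.
  case/mxvec_indexP: k => i j; have := frob_entry (vec_mx u) i j.
  by rewrite mxE => /le_trans; apply.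
by apply: le_trans uk _; nra.
Qed.

(** The sublevel sets of the largest Frobenius norm along the orbit are compact and
    nested, so the infimum is attained; by [admissible_midpoint] it is attained at
    one form only. As the group permutes the minimisers, it fixes this form. *)
Lemma invariant_form : exists q : 'M[R]_n,
  [/\ q^T = q, forall x : 'rV[R]_n, x != 0 -> 0 < (x *m q *m x^T) 0 0 &
      forall M, S M -> M *m q *m M^T = q].
Proof.
have level_gt r : a < r -> exists q, admissible r q.
  move=> ar; have [s [q sq] sr] := inf_lt levels_inf.1 ar.
  by exists q; apply: admissible_le sq; exact: ltW.
pose F := filter_from [set r | a < r] vec_admissible.
have FF : ProperFilter F.
  apply: filter_from_proper; last first.
    by move=> r /level_gt[q rq]; exists (mxvec q); rewrite /vec_admissible /= mxvecK.
  apply: filter_from_filter; first by exists (a + 1); rewrite /= ltrDl.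
  move=> r s ar as_; exists (Num.min r s); first by rewrite /= lt_min ar.
  by move=> u au; split; apply: admissible_le au; rewrite ge_min lexx ?orbT.
have a1 : a < a + 1 by rewrite ltrDl.
have Fa1 : F (vec_admissible (a + 1)) by exists (a + 1).
have [u [_ clu]] := @compact_admissible (a + 1) F FF Fa1.
have au : admissible a (vec_mx u).
  have aur r : a < r -> admissible r (vec_mx u).
    move=> ar; apply: (@closed_admissible r).
    by move: clu; rewrite clusterE; apply; exists r.
  split.
  - by have [] := aur _ a1.
  - by have [] := aur _ a1.
  - move=> M SMM; apply/ler_addgt0Pl => e e0; rewrite addrC.
    by have [_ _] := aur (a + e) (ltac:(by rewrite ltrDl)); apply.
exists (vec_mx u); split.
- by have [] := au.
- move=> x x0; have [_ /(_ _ x S1) + _] := au.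
  rewrite /act mul1mx trmx1 mulmx1; apply: lt_le_trans.
  rewrite lt_def frob_ge0 andbT; apply: contra x0 => /eqP f0.
  by rewrite (@frob_eq0 _ _ _ x) ?f0.
- move=> M SMM; apply/eqP; rewrite -subr_eq0; apply/eqP/frob_eq0.
  have := admissible_close (admissible_act SMM au) au.
  by rewrite subrr mulr0.
Qed.

End InvariantForm.

(** * An ad-invariant inner product for a compact group *)
Section AdInvariant.
Context {R : realType} {n : nat}.
Variable H : lieGroupType 'rV[R]_n.
Hypothesis H_compact : compact [set: H].

Lemma compact_Cinf_bounded (f : Cinf H) : exists b : R, forall g, `|f g| <= b.
Proof.
have cf : compact (f @` [set: H]).
  apply: continuous_compact => //; apply: continuous_subspaceT.
  exact: Cinf_continuous.
have [M [_ HM]] := compact_bounded cf.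
exists (M + 1) => g; apply: (HM (M + 1)); first by rewrite ltrDl.
by exists g.
Qed.

Definition mx_form (q : 'M[R]_n) (x y : 'rV[R]_n) : R := (x *m q *m y^T) 0 0.

Lemma mx_formE q x y : mx_form q x y = \sum_i \sum_j q i j * (x 0 i * y 0 j).
Proof.
rewrite /mx_form mxE exchange_big; apply: eq_bigr => j _.
rewrite !mxE mulr_suml; apply: eq_bigr => i _; ring.
Qed.

(** The entries of the matrix of [adj g] are smooth functions of g, hence bounded, so
    [invariant_form] applies. The function Q of g in the proof is the value of the
    form at (adj g X, adj g Y), written with the smooth functions of [adj_smooth];
    it is constant, and its derivative along Z is the left-hand side. *)
Lemma invariant_metric : exists q : 'M[R]_n,
  [/\ q^T = q, forall x, x != 0 -> 0 < mx_form q x x &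
   forall X Y Z : lieAlg H,
     mx_form q (tangent (lie_bracket X Z)) (tangent Y) +
     mx_form q (tangent X) (tangent (lie_bracket Y Z)) = 0].
Proof.
have [e eE] := choice (fun i : 'I_n => tangent_surj H (delta_mx 0 i)).
have [f fE] := choice (fun i : 'I_n =>
  coordinate_function (frE := frame_rV n) (unit_chart_atlas H) (unit_chart1 H) i).
have {}fE i (X : lieAlg H) : X (f i) 1%g = tangent X 0 i.
  by rewrite tangentP fE.
pose M g : 'M[R]_n :=
  \matrix_i @tangent _ _ (frame_rV n) H (@adj _ _ (frame_rV n) H g (e i)).
have tlin := @tangent_linear _ _ (frame_rV n) H.
pose T : {linear lieAlg H -> 'rV[R]_n} := HB.pack (@tangent _ _ (frame_rV n) H)
  (GRing.isLinear.Build _ _ _ _ _ tlin).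
have alin g := @adj_linear _ _ (frame_rV n) H g.
have ME g X : tangent (adj g X) = tangent X *m M g.
  pose D : {linear lieAlg H -> lieAlg H} := HB.pack (@adj _ _ (frame_rV n) H g)
    (GRing.isLinear.Build _ _ _ _ _ (alin g)).
  have XE : X = \sum_i tangent X 0 i *: e i.
    apply: tangent_inj; rewrite -[RHS]/(T _) linear_sum [LHS]row_sum_delta.
    by apply: eq_bigr => i _; rewrite linearZ /= eE.
  rewrite {1}XE -[LHS]/(T (D _)) !linear_sum [in RHS](row_sum_delta (tangent X)).
  rewrite mulmx_suml; apply: eq_bigr => i _.
  by rewrite !linearZ /= -scalemxAl -rowE rowK.
have S1 : range M 1%:M.
  exists 1%g => //; apply/row_matrixP => i.
  by rewrite rowK adj_id eE row1.
have MM g h : M g *m M h = M (g * h)%g.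
  by apply/row_matrixP => i; rewrite row_mul !rowK -ME adj_mul.
have SM A B : range M A -> range M B -> range M (A *m B).
  by move=> [g _ <-] [h _ <-]; exists (g * h)%g; rewrite ?MM.
have M1 : M 1%g = 1%:M by apply/row_matrixP => i; rewrite rowK adj_id eE row1.
have SV A : range M A -> exists2 B, range M B & A *m B = 1%:M.
  by move=> [g _ <-]; exists (M g^-1%g); [exists g^-1%g|rewrite MM mulgV].
have [b bE] : exists b, forall A, range M A -> forall i j, `|A i j| <= b.
  have bij (k : 'I_n * 'I_n) : exists b : R, forall g, `|M g k.1 k.2| <= b.
    have [h [hE _]] := adj_smooth (e k.1) (f k.2).
    have [b hb] := compact_Cinf_bounded h; exists b => g.
    by rewrite mxE -fE -hE.
  have [b bE] := choice bij; exists (\sum_k `|b k|) => _ [g _ <-] i j.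
  apply: le_trans (bE (i, j) g) _; apply: le_trans (ler_norm _) _.
  by rewrite (bigD1 (i, j))//= lerDl sumr_ge0.
have [q [qT q0 qM]] := invariant_form S1 SM SV bE.
exists q; split=> // X Y Z.
have [hX hXE] := choice (fun i => adj_smooth X (f i)).
have [hY hYE] := choice (fun i => adj_smooth Y (f i)).
pose Q : Cinf H := \sum_i \sum_j q i j *: (hX i * hY j).
have QE g : Q g = mx_form q (tangent X) (tangent Y).
  have -> : mx_form q (tangent X) (tangent Y) =
      mx_form q (tangent (adj g X)) (tangent (adj g Y)).
    rewrite !ME /mx_form trmx_mul !mulmxA -(mulmxA _ (M g) q).
    by rewrite -(mulmxA _ (M g *m q)) qM//; exists g.
  rewrite mx_formE Cinf_sumE; apply: eq_bigr => i _; rewrite Cinf_sumE.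
  apply: eq_bigr => j _; rewrite CinfZE CinfME (hXE i).1 (hYE j).1.
  by rewrite !fE.
have ZQ : Z Q 1%g = 0 by rewrite (livf_cst Z QE).
have [_ leib _] := lieAlgP Z.
have Zsum (I : finType) (F : I -> Cinf H) : Z (\sum_i F i) = \sum_i Z (F i).
  elim/big_rec2: _ => [|i x y _ <-]; last by rewrite livfD.
  by rewrite (livf_cst Z (a := 0)).
have hX1 i : hX i 1%g = tangent X 0 i by rewrite (hXE i).1 adj_id fE.
have hY1 i : hY i 1%g = tangent Y 0 i by rewrite (hYE i).1 adj_id fE.
rewrite -ZQ !mx_formE -big_split /Q Zsum Cinf_sumE; apply: eq_bigr => i _ /=.
rewrite -big_split Zsum Cinf_sumE; apply: eq_bigr => j _ /=.
rewrite livfZ CinfZE leib CinfDE !CinfME hX1 hY1.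
by rewrite (hXE i).2 (hYE j).2 !fE mulrDr.
Qed.

End AdInvariant.

(** * The almost Hermitian structure and its Gauduchon connections *)
Section Bracket.
Context {R : realType} {E : normedModType R} {frE : frame E}.
Variable G : lieGroupType E.
Implicit Types X Y Z : lieAlg G.

Lemma livfB X f h : X (f - h) = X f - X h.
Proof. by rewrite livfD livfN. Qed.

Lemma lie_bracketE X Y f : lie_bracket X Y f = X (Y f) - Y (X f).
Proof. by []. Qed.

Lemma lieAlgN X f : (- X) f = - X f.
Proof. by []. Qed.

Lemma lieAlgD X Y f : (X + Y) f = X f + Y f.
Proof. by []. Qed.

Lemma lie_bracketC X Y : lie_bracket X Y = - lie_bracket Y X.
Proof. by apply: lieAlg_eq => f; rewrite lieAlgN !lie_bracketE opprB. Qed.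

Lemma lie_bracket_linearl a X Y Z :
  lie_bracket (a *: X + Y) Z = a *: lie_bracket X Z + lie_bracket Y Z.
Proof.
apply: lieAlg_eq => f; rewrite !(lieAlgE, lie_bracketE) livfD.
by rewrite livfZ scalerBr addrACA opprD.
Qed.

Lemma jacobi X Y Z : lie_bracket (lie_bracket X Y) Z =
  lie_bracket X (lie_bracket Y Z) - lie_bracket Y (lie_bracket X Z).
Proof.
apply: lieAlg_eq => f.
rewrite !(lieAlgD, lieAlgN, lie_bracketE) !livfB.
have CinfBE (u v : Cinf G) q : (u - v) q = u q - v q by [].
by rewrite !CinfBE; ring.
Qed.

End Bracket.

(** The construction, for any Lie algebra with coordinates (v1, v2) in V x V in
    which the bracket is br on the first components and 0 on the second one, and
    with an inner product B on V that is invariant under br. *)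
Section Construction.
Context {R : realType} {E : normedModType R} {G : lieGroupType E}.
Context {V : lmodType R}.
Local Notation g := (lieAlg G).
Variables (v1 v2 : {linear g -> V}) (mk : V -> V -> g).
Variables (br : V -> V -> V) (B : V -> V -> R).
Hypothesis v_inj : forall X Y, v1 X = v1 Y -> v2 X = v2 Y -> X = Y.
Hypothesis v1_mk : forall x y, v1 (mk x y) = x.
Hypothesis v2_mk : forall x y, v2 (mk x y) = y.
Hypothesis v1_bracket : forall X Y, v1 (lie_bracket X Y) = br (v1 X) (v1 Y).
Hypothesis v2_bracket : forall X Y, v2 (lie_bracket X Y) = 0.
Hypothesis br_linear : forall z, linear (br^~ z).
Hypothesis brC : forall x y, br x y = - br y x.
Hypothesis br_jacobi : forall x y z, br (br x y) z = br x (br y z) - br y (br x z).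
Hypothesis B_linear : forall a x y z, B (a *: x + y) z = a * B x z + B y z.
Hypothesis B_sym : forall x y, B x y = B y x.
Hypothesis B_pos : forall x, x != 0 -> 0 < B x x.
Hypothesis B_inv : forall x y z, B (br x z) y + B x (br y z) = 0.

Definition almost_complex (X : g) : g := mk (- v2 X) (v1 X).
Definition metric (X Y : g) : R := B (v1 X) (v1 Y) + B (v2 X) (v2 Y).
Definition gauduchon (t : R) (X Y : g) : g :=
  ((2 - t) / 4) *: mk (br (v1 X) (v1 Y)) (br (v1 X) (v2 Y)).

Local Notation J := almost_complex.
Local Notation ip := metric.
Local Notation nabla := gauduchon.

Let BD x y z : B (x + y) z = B x z + B y z.
Proof. by rewrite -[x]scale1r B_linear mul1r scale1r. Qed.
Let B0 z : B 0 z = 0.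
Proof. by apply: (addrI (B 0 z)); rewrite -BD !addr0. Qed.
Let BZ a x z : B (a *: x) z = a * B x z.
Proof. by rewrite -[a *: x]addr0 B_linear B0 addr0. Qed.
Let BN x z : B (- x) z = - B x z.
Proof. by rewrite -scaleN1r BZ mulN1r. Qed.
Let BE := (BD, BZ, BN, B0).
Let BDr x y z : B z (x + y) = B z x + B z y.
Proof. by rewrite B_sym BD B_sym [B y z]B_sym. Qed.
Let BZr a x z : B z (a *: x) = a * B z x.
Proof. by rewrite B_sym BZ B_sym. Qed.
Let BNr x z : B z (- x) = - B z x.
Proof. by rewrite B_sym BN B_sym. Qed.
Let B0r z : B z 0 = 0.
Proof. by rewrite B_sym B0. Qed.
Let BrE := (BDr, BZr, BNr, B0r).

Let brD x y z : br (x + y) z = br x z + br y z.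
Proof. by rewrite -[x]scale1r br_linear !scale1r. Qed.
Let br0 z : br 0 z = 0.
Proof. by apply: (addrI (br 0 z)); rewrite -brD !addr0. Qed.
Let brZ a x z : br (a *: x) z = a *: br x z.
Proof. by rewrite -[a *: x]addr0 br_linear br0 addr0. Qed.
Let brN x z : br (- x) z = - br x z.
Proof. by rewrite -scaleN1r brZ scaleN1r. Qed.
Let brNr x z : br z (- x) = - br z x.
Proof. by rewrite brC brN opprK brC. Qed.
Let brZr a x z : br z (a *: x) = a *: br z x.
Proof. by rewrite brC brZ -scalerN -brC. Qed.
Let brDr x y z : br z (x + y) = br z x + br z y.
Proof. by rewrite brC brD opprD -!brC. Qed.

(* By [brC] and [B_inv] the trilinear form c is alternating. *)
Let c x y z : R := B (br x y) z.
Let cC x y z : c y x z = - c x y z.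
Proof. by rewrite /c brC BN. Qed.
Let c13 x y z : c z y x = - c x y z.
Proof.
by have := B_inv z x y; rewrite /c [B z _]B_sym => /eqP; rewrite addr_eq0 => /eqP.
Qed.
Let c_cyc x y z : c y z x = c x y z.
Proof. by rewrite (c13 x z y) (cC z x y) (c13 y x z) (cC x y z) !opprK. Qed.

Let c23 x y z : c x z y = - c x y z.
Proof. by rewrite (c13 y z x) (c_cyc x y z). Qed.
Let B_br x y z : B y (br x z) = - c x y z.
Proof. by rewrite B_sym -c23. Qed.

Let v1_J X : v1 (J X) = - v2 X. Proof. exact: v1_mk. Qed.
Let v2_J X : v2 (J X) = v1 X. Proof. exact: v2_mk. Qed.
Let v1_nabla t X Y : v1 (nabla t X Y) = ((2 - t) / 4) *: br (v1 X) (v1 Y).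
Proof. by rewrite linearZ /= v1_mk. Qed.
Let v2_nabla t X Y : v2 (nabla t X Y) = ((2 - t) / 4) *: br (v1 X) (v2 Y).
Proof. by rewrite linearZ /= v2_mk. Qed.
Let vE := (v1_J, v2_J, v1_nabla, v2_nabla, v1_bracket, v2_bracket).

Lemma metric_is_inner_product : is_inner_product ip.
Proof.
split=> [a X Y Z|X Y|X X0]; rewrite /ip.
- by rewrite !linearP !B_linear; ring.
- by rewrite B_sym [B (v2 X) _]B_sym.
- have B_ge0 x : 0 <= B x x.
    by have [->|/B_pos/ltW//] := eqVneq x 0; rewrite B0.
  have [x0|x0] := eqVneq (v1 X) 0; last by rewrite ltr_pwDl// B_pos.
  have [y0|y0] := eqVneq (v2 X) 0; last by rewrite ltr_wpDl// B_pos.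
  by move: X0; rewrite (v_inj (X := X) (Y := 0)) ?eqxx// linear0.
Qed.

Lemma almost_hermitian : is_almost_hermitian J ip.
Proof.
split; last 2 first.
- exact: metric_is_inner_product.
- by move=> X Y; rewrite /ip !vE !BE !BrE opprK addrC.
- by move=> a X Y; apply: v_inj; rewrite !(linearP, vE) ?opprD ?scalerN.
- by move=> X; apply: v_inj; rewrite !(linearN, vE).
Qed.

Let omega_deriv X Y Z : ext_deriv2 (fundamental_form J ip) X Y Z =
  - c (v1 X) (v1 Y) (v2 Z) - c (v1 Y) (v1 Z) (v2 X) - c (v1 Z) (v1 X) (v2 Y).
Proof.
by rewrite /ext_deriv2 /fundamental_form /ip !vE oppr0 !B0 !add0r.
Qed.

Lemma gauduchon_is_gauduchon t : is_gauduchon J ip t (nabla t).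
Proof.
split.
- move=> Z a X Y; apply: v_inj; rewrite !(linearP, vE) brD brZ scalerDr !scalerA;
  by rewrite [a * _]mulrC.
- move=> X a Y Z; apply: v_inj; rewrite !(linearP, vE) brDr brZr scalerDr !scalerA;
  by rewrite [a * _]mulrC.
- move=> X Y Z; rewrite /ip !vE !BE !BrE.
  by rewrite !B_br /c; ring.
move=> X Y Z; rewrite /plus_part /torsion_form /torsion /nijenhuis.
rewrite !omega_deriv /ip !(linearD, linearB, linearN) /= !vE.
set x := v1 X; set x' := v2 X; set y := v1 Y; set y' := v2 Y.
set z := v1 Z; set z' := v2 Z.
rewrite ?(oppr0, brN, brNr, BE, BrE) /c ?(oppr0, brN, brNr, BE, BrE) -!/(c _ _ _).
have cyc p q r : (c q r p = c p q r) * (c r p q = c p q r) * (c q p r = - c p q r).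
  by split; [split; [exact: c_cyc|rewrite -c_cyc]|exact: cC].
(* Each term is brought to the order (X, Y, Z) of its arguments; what remains is
   an identity between the coefficients of eight independent values of c. *)
rewrite !(cyc x y z, cyc x y z', cyc x y' z, cyc x y' z',
  cyc x' y z, cyc x' y z', cyc x' y' z, cyc x' y' z').
by field.
Qed.

(** The difference d of two such connections is symmetric in its first two arguments
    as the torsions agree, and skew in the last two as both are metric; going round
    the six permutations, d = - d. *)
Lemma gauduchon_unique t nabla' : is_gauduchon J ip t nabla' -> nabla t = nabla'.
Proof.
move=> [_ _ met' tor']; have [_ _ met tor] := gauduchon_is_gauduchon t.
have [ipL ipC ipP] := metric_is_inner_product.
have ipB U W Z : ip (U - W) Z = ip U Z - ip W Z.
  by rewrite -scaleN1r addrC ipL mulN1r addrC.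
pose d X Y Z := ip (nabla t X Y) Z - ip (nabla' X Y) Z.
have d12 X Y Z : d X Y Z = d Y X Z.
  have := tor X Y Z; rewrite /= -tor' /torsion_form /torsion !ipB /d; lra.
have d23 X Y Z : d X Y Z = - d X Z Y.
  have := met X Y Z; have := met' X Y Z.
  rewrite [ip Y (nabla t X Z)]ipC [ip Y (nabla' X Z)]ipC /d; lra.
have d0 X Y Z : d X Y Z = 0.
  have := d12 X Y Z; have := d23 Y X Z; have := d12 Y Z X; have := d23 Z Y X.
  have := d12 Z X Y; have := d23 X Z Y; lra.
apply/funext => X; apply/funext => Y; apply/eqP; rewrite -subr_eq0.
by apply/negPn/negP => /ipP; rewrite ipB -/(d X Y _) d0 ltxx.
Qed.

Lemma torsion_form2 X Y Z :
  torsion_form ip (nabla 2) X Y Z = - c (v1 X) (v1 Y) (v1 Z).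
Proof.
rewrite /torsion_form /torsion /ip !(linearD, linearB, linearN) /= !vE.
by rewrite subrr mul0r !scale0r !(subrr, sub0r, oppr0, BE, addr0).
Qed.

Lemma gauduchon2_trivial : trivial_connection (nabla 2).
Proof. by move=> X Y; rewrite /nabla subrr mul0r scale0r. Qed.

Lemma gauduchon2_skew : totally_skew (torsion_form ip (nabla 2)).
Proof.
move=> X Y Z; rewrite !torsion_form2; split; first by rewrite cC.
by rewrite c23 opprK.
Qed.

(** By invariance c ([a, b], p, q) is <[a, b], [p, q]>, symmetric in the two pairs; so
    the six terms of the exterior derivative come in three equal pairs, whose sum is
    twice the Jacobi identity. *)
Lemma gauduchon2_closed : closed3 (torsion_form ip (nabla 2)).
Proof.
move=> X Y Z W; rewrite /ext_deriv3 !torsion_form2 !v1_bracket.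
set x := v1 X; set y := v1 Y; set z := v1 Z; set w := v1 W.
have pairE a b p q : c (br a b) p q = c (br p q) a b.
  by rewrite -[LHS]c_cyc -[RHS]c_cyc /c B_sym.
rewrite (pairE z w x y) (pairE x w y z) (pairE y w x z).
have : B (br (br x y) z - br (br x z) y + br (br y z) x) w = 0.
  rewrite br_jacobi [br (br x z) y]brC [br (br y z) x]brC opprK.
  by rewrite subrK subrr B0.
rewrite !BE /c; lra.
Qed.

Let scaleN2 : (2 - (-2)) / 4 = 1 :> R. Proof. by field. Qed.
Let v1_nablaN2 X Y : v1 (nabla (-2) X Y) = br (v1 X) (v1 Y).
Proof. by rewrite v1_nabla scaleN2 scale1r. Qed.
Let v2_nablaN2 X Y : v2 (nabla (-2) X Y) = br (v1 X) (v2 Y).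
Proof. by rewrite v2_nabla scaleN2 scale1r. Qed.

(** Flatness is the Jacobi identity in each component. *)
Lemma gauduchonN2_flat : flat_connection (nabla (-2)).
Proof.
move=> X Y Z; rewrite /curvature; apply: v_inj; rewrite !linearB linear0.
  by rewrite !v1_nablaN2 v1_bracket br_jacobi subrr.
by rewrite !(v2_nablaN2, v1_nablaN2) v1_bracket br_jacobi subrr.
Qed.

Lemma gauduchonN2_trivial (h : set g) :
  trivial_connection (nabla (-2)) -> abelian_subset h.
Proof.
move=> tr X Y _ _; apply: v_inj; rewrite linear0 ?v2_bracket// v1_bracket.
by have := congr1 v1 (tr X Y); rewrite v1_nablaN2 linear0.
Qed.

Lemma almost_complex_totally_real (h k : set g) :
  (forall X, h X <-> v2 X = 0) -> (forall X, k X <-> v1 X = 0) -> J @` h = k.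
Proof.
move=> hP kP; apply/seteqP; split=> [_ [X /hP X0 <-]|Y /kP Y0].
  by apply/kP; rewrite v1_J X0 oppr0.
exists (mk (v2 Y) 0); first by apply/hP.
by apply: v_inj; rewrite !vE ?v1_mk ?v2_mk ?oppr0.
Qed.

End Construction.

Theorem theorem4p11 (R : realType) (n : nat)
    (H A : lieGroupType 'rV[R]_n)
    (H_compact : compact [set: H])
    (A_abelian : forall x y : A, (x * y)%g = (y * x)%g) :
  exists (J : lieAlg (H * A)%type -> lieAlg (H * A)%type)
         (ip : lieAlg (H * A)%type -> lieAlg (H * A)%type -> R)
         (nabla : R -> lieAlg (H * A)%type -> lieAlg (H * A)%type ->
                  lieAlg (H * A)%type),
    is_almost_hermitian J ip /\
    (forall t : R, unique (is_gauduchon J ip t) (nabla t)) /\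
    totally_real J /\
    (trivial_connection (nabla 2) /\ totally_skew (torsion_form ip (nabla 2))) /\
    (flat_connection (nabla (-2)) /\
     (~ abelian_subset (lie_factor1 H A) -> ~ trivial_connection (nabla (-2)))) /\
    closed3 (torsion_form ip (nabla 2)).
Proof.
have [q [qT q_pos q_inv]] := invariant_metric H_compact.
pose tH : {linear lieAlg H -> 'rV[R]_n} := HB.pack (@tangent _ _ (frame_rV n) H)
  (GRing.isLinear.Build _ _ _ _ _ (@tangent_linear _ _ (frame_rV n) H)).
pose tA : {linear lieAlg A -> 'rV[R]_n} := HB.pack (@tangent _ _ (frame_rV n) A)
  (GRing.isLinear.Build _ _ _ _ _ (@tangent_linear _ _ (frame_rV n) A)).
pose fr := frame_rV (R := R) n.
pose pr1 := @proj1_lie _ _ _ fr fr H A.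
pose pr2 := @proj2_lie _ _ _ fr fr H A.
pose u1 (X : lieAlg (H * A)%type) := tH (pr1 X).
pose u2 (X : lieAlg (H * A)%type) := tA (pr2 X).
have u1_linear : linear u1.
  by move=> a X Y; rewrite /u1 /pr1 proj1_linear linearP.
have u2_linear : linear u2.
  by move=> a X Y; rewrite /u2 /pr2 proj2_linear linearP.
pose v1 : {linear lieAlg (H * A)%type -> 'rV[R]_n} := HB.pack u1
  (GRing.isLinear.Build _ _ _ _ _ u1_linear).
pose v2 : {linear lieAlg (H * A)%type -> 'rV[R]_n} := HB.pack u2
  (GRing.isLinear.Build _ _ _ _ _ u2_linear).
have [lift liftK] := choice (@tangent_surj _ _ (frame_rV n) H).
have tH_lift : cancel tH lift.
  by move=> X; apply: (@tangent_inj _ _ (frame_rV n) H); rewrite liftK.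
have mk_ex (xy : 'rV[R]_n * 'rV[R]_n) :
    exists X : lieAlg (H * A)%type, v1 X = xy.1 /\ v2 X = xy.2.
  have [X1 X1E] := tangent_surj H xy.1; have [X2 X2E] := tangent_surj A xy.2.
  have [X [XX1 XX2]] := proj_surj X1 X2.
  by exists X; rewrite /= /u1 /u2 /pr1 /pr2 XX1 XX2.
have [mk' mkE] := choice mk_ex; pose mk x y := mk' (x, y).
have v_inj X Y : v1 X = v1 Y -> v2 X = v2 Y -> X = Y.
  by move=> /tangent_inj XY1 /tangent_inj XY2; apply: proj_inj.
have v1_mk x y : v1 (mk x y) = x by exact: (mkE (x, y)).1.
have v2_mk x y : v2 (mk x y) = y by exact: (mkE (x, y)).2.
pose br x y := tH (lie_bracket (lift x) (lift y)).
have v1_bracket X Y : v1 (lie_bracket X Y) = br (v1 X) (v1 Y).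
  by rewrite /= /u1 /pr1 /br proj1_bracket !tH_lift.
have v2_bracket X Y : v2 (lie_bracket X Y) = 0.
  by rewrite /= /u2 /pr2 proj2_bracket lie_bracket_abelian// linear0.
have tHK x : tH (lift x) = x by exact: liftK.
have br_linear z : linear (br^~ z).
  move=> a x y; rewrite /br (_ : lift _ = a *: lift x + lift y).
    by rewrite lie_bracket_linearl linearP.
  by apply: (@tangent_inj _ _ (frame_rV n) H); rewrite -![tangent _]/(tH _) linearP !tHK.
have brC x y : br x y = - br y x by rewrite /br lie_bracketC linearN.
have br_jacobi x y z : br (br x y) z = br x (br y z) - br y (br x z).
  by rewrite /br !tH_lift jacobi linearB.
pose B := @mx_form R n q.
have B_linear a x y z : B (a *: x + y) z = a * B x z + B y z.
  by rewrite /B /mx_form !mulmxDl -!scalemxAl !mxE.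
have B_sym x y : B x y = B y x.
  have -> : B x y = (x *m q *m y^T)^T 0 0 by rewrite mxE.
  by rewrite !trmx_mul trmxK qT mulmxA.
have B_inv x y z : B (br x z) y + B x (br y z) = 0.
  by have := q_inv (lift x) (lift y) (lift z); rewrite -![tangent _]/(tH _) !tHK.
pose J := @almost_complex _ _ _ _ v1 v2 mk.
pose ip := @metric _ _ _ _ v1 v2 B.
pose nabla := @gauduchon _ _ _ _ v1 v2 mk br.
exists J, ip, nabla; split; [|split; [|split; [|split; [|split]]]].
- exact: almost_hermitian.
- move=> t; split; first exact: gauduchon_is_gauduchon.
  by move=> nabla'; apply: gauduchon_unique.
- apply: (almost_complex_totally_real v_inj v1_mk v2_mk) => X.
    rewrite lie_factor1P /= /u2 /pr2; split=> [->|X0]; first exact: linear0.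
    by apply: (@tangent_inj _ _ (frame_rV n) A); rewrite -![tangent _]/(tA _) X0 linear0.
  rewrite lie_factor2P /= /u1 /pr1; split=> [->|X0]; first exact: linear0.
  by apply: (@tangent_inj _ _ (frame_rV n) H); rewrite -![tangent _]/(tH _) X0 linear0.
- split; first exact: gauduchon2_trivial.
  exact: gauduchon2_skew.
- split; first exact: gauduchonN2_flat.
  by move=> nab tr; apply: nab; exact: gauduchonN2_trivial tr.
- exact: gauduchon2_closed.
Qed.
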